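(* Let $\nu\in\mathbb{N}\cup\{\infty,\omega\}$, let $(\mathcal{X}=\{X_0,\ldots,X_m\},\mathfrak{C})$ be a $\mathrm{C}^{\nu}$ control-affine system on $\mathbb{R}^n$ which satisfies the Assumption stated in the context, let $x_0\in\mathbb{R}^n$ be an equilibrium point of $\mathcal{X}$, and let $N\in\mathbb{N}$. Then the following statements are equivalent: (i) $\mathcal{X}$ satisfies the growth rate condition of order $N$ at $x_0$; (ii) $\widehat{\mathcal{K}}^N_{\mathcal{X}}(x_0)=\mathbb{R}^n$.
   Context: A $\mathrm{C}^\nu$ control-affine system on $\mathbb{R}^n$ is a pair $(\mathcal{X},\mathfrak{C})$, where $\mathcal{X}=\{X_0,X_1,\ldots,X_m\}$ is an ordered family of $\mathrm{C}^\nu$ vector fields on $\mathbb{R}^n$ ($\omega$ means real analytic) and $\mathfrak{C}\subseteq\mathbb{R}^m$ is a set with $0\in\mathfrak{C}$. A trajectory is an absolutely continuous curve $x:[0,T]\to\mathbb{R}^n$ such that $\dot x(t)=X_0(x(t))+\sum_{i=1}^m u_i(t)X_i(x(t))$ for almost every $t\in[0,T]$, for some measurable control $u=(u_1,\ldots,u_m):[0,T]\to\mathfrak{C}$. The reachable set from $x_0$ in time at most $t$ is $$\mathrm{R}_{\mathcal{X}}(\le t,x_0)=\{x(T)\mid x:[0,T]\to\mathbb{R}^n\text{ is a trajectory of }\mathcal{X},\ x(0)=x_0,\ 0\le T\le t\}.$$ The point $x_0$ is an equilibrium point if $X_0(x_0)=0$. $\overline{\mathrm{B}}(x_0,r)$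 is the closed Euclidean ball. Growth rate condition of order $N$ at $x_0$: there exist $C,T>0$ such that for every $t\in(0,T]$, $\overline{\mathrm{B}}(x_0,Ct^N)\subset\mathrm{R}_{\mathcal{X}}(\le t,x_0)$. Control variations: for $k\in\mathbb{N}$, a vector $\mathbf{v}\in\mathbb{R}^n$ is a variation of $k$th order for $\mathcal{X}$ at $x_0$ if there is a map $\gamma:\mathbb{R}_{\ge0}\to\mathbb{R}^n$ (no regularity required) such that $\gamma(t)\in\mathrm{R}_{\mathcal{X}}(\le t,x_0)$ for every $t\ge0$ and $\gamma(t)=x_0+t^k\mathbf{v}+\mathcal{O}(t^{k+1})$. Here $f(t)=g(t)+\mathcal{O}(t^{j})$ means, by the paper's convention, that $\lim_{t\to0}\|f(t)-g(t)\|/|t|^{j}$ exists and is finite (for maps on $\mathbb{R}_{\ge 0}$, the limit is one-sided). $\mathcal{K}^k_{\mathcal{X}}(x_0)$ is the set of all variations of $k$th order, and $\widehat{\mathcal{K}}^k_{\mathcal{X}}(x_0)=\bigcup_{\alpha\ge0}\alpha\,\mathcal{K}^k_{\mathcal{X}}(x_0)$. For $\mathbf{u}=(u_1,\ldots,u_m)\in\mathfrak{C}$ write $X_{\mathbf{u}}=X_0+\sum_{i=1}^m u_iX_i$. For $p\ge1$, $\mathbf{I}=(\mathbf{u}^1,\ldots,\mathbf{u}^p)\in\mathfrak{C}^p$ and $\mathbf{t}=(t_1,\ldots,t_p)\in\mathbb{R}_{>0}^p$, let $X^{\mathbf{I},\mathbf{t}}$ be the time-dependent vector field on the time interval $[0,t_1+\cdots+t_p]$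 equal to $X_{\mathbf{u}^p}$ on $[0,t_p]$, to $X_{\mathbf{u}^{p-1}}$ on $(t_p,t_{p-1}+t_p]$, ..., and to $X_{\mathbf{u}^1}$ on $(t_2+\cdots+t_p,t_1+\cdots+t_p]$. Assumption on $(\mathcal{X},\mathfrak{C})$: (i) for all $p\ge 1$, $\mathbf{I}\in\mathfrak{C}^p$ and $\mathbf{t}\in\mathbb{R}_{>0}^p$, the vector field $X^{\mathbf{I},\mathbf{t}}$ is complete, i.e. for every initial point its integral curve exists for all times at which the vector field is defined; (ii) $\mathfrak{C}=[-1,1]^m$. *)

(* Defs.v *)
From HB Require Import structures.
From mathcomp Require Import all_boot all_order all_algebra.
From mathcomp Require Import all_classical all_reals all_analysis.

Set Implicit Arguments.
Unset Strict Implicit.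
Unset Printing Implicit Defensive.

Import Order.TTheory GRing.Theory Num.Theory.
Import numFieldNormedType.Exports.

Local Open Scope classical_set_scope.
Local Open Scope ring_scope.

(* Points of R^n are row vectors. The library norm `|x| on 'rV[R]_n is the sup
   norm, hence a separate Euclidean norm. *)
Definition enorm (R : realType) (n : nat) (x : 'rV[R]_n) : R :=
  Num.sqrt (\sum_(i < n) x ord0 i ^+ 2).

Definition eclosed_ball (R : realType) (n : nat) (c : 'rV[R]_n) (r : R) :
    set 'rV[R]_n :=
  [set x | enorm (x - c) <= r].

Definition partial (R : realType) (n : nat) (i : 'I_n) (f : 'rV[R]_n -> R) :
    'rV[R]_n -> R :=
  fun x => 'D_(delta_mx ord0 i) f x.

Fixpoint Ck (R : realType) (n k : nat) (f : 'rV[R]_n -> R) : Prop :=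
  match k with
  | 0 => continuous f
  | k'.+1 => continuous f /\
      forall i : 'I_n, (forall x, derivable f x (delta_mx ord0 i)) /\
                       Ck k' (partial i f)
  end.

Definition Cinfty (R : realType) (n : nat) (f : 'rV[R]_n -> R) : Prop :=
  forall k, Ck k f.

Definition mpartial (R : realType) (n : nat) (al : 'I_n -> nat)
    (f : 'rV[R]_n -> R) : 'rV[R]_n -> R :=
  foldr (fun i g => iter (al i) (partial i) g) f (enum 'I_n).

Definition taylor_term (R : realType) (n : nat) (f : 'rV[R]_n -> R)
    (a x : 'rV[R]_n) (al : 'I_n -> nat) : R :=
  mpartial al f a / (\prod_(i < n) ((al i)`!)%:R)
  * \prod_(i < n) (x ord0 i - a ord0 i) ^+ al i.

(* Convergence of a multi-indexed series means absolute convergence; partial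
   sums are taken over the boxes of multi-indices with all entries < K. *)
Definition Comega (R : realType) (n : nat) (f : 'rV[R]_n -> R) : Prop :=
  Cinfty f /\
  forall a : 'rV[R]_n, \forall x \near a,
    (exists M : R, forall K : nat,
       \sum_(al : {ffun 'I_n -> 'I_K})
         `|taylor_term f a x (fun i => al i : nat)| <= M) /\
    (fun K : nat => \sum_(al : {ffun 'I_n -> 'I_K})
         taylor_term f a x (fun i => al i : nat)) @ \oo --> f x.

(* N u {oo, omega}, with N the positive integers. *)
Inductive regularity : Type :=
  | RegFin (k : nat) of (0 < k)%N
  | RegInfty
  | RegOmega.

Definition of_class (R : realType) (n : nat) (nu : regularity)
    (f : 'rV[R]_n -> R) : Prop :=
  match nu with
  | RegFin k _ => Ck k f
  | RegInfty => Cinfty f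
  | RegOmega => Comega f
  end.

(* [vf ord0] is the drift X_0 and [vf (lift ord0 i)] is the (i+1)-st control
   vector field. *)
Record control_affine_system (R : realType) (nu : regularity) (n m : nat) :=
  ControlAffineSystem {
    vf : 'I_m.+1 -> 'rV[R]_n -> 'rV[R]_n ;
    controls : set 'rV[R]_m ;
    vf_class : forall (j : 'I_m.+1) (i : 'I_n),
      of_class nu (fun x => vf j x ord0 i) ;
    controls0 : controls 0
  }.

Definition field_at (R : realType) (nu : regularity) (n m : nat)
    (S : control_affine_system R nu n m) (u : 'rV[R]_m) (x : 'rV[R]_n) :
    'rV[R]_n :=
  vf S ord0 x + \sum_(i < m) u ord0 i *: vf S (lift ord0 i) x.

Definition equilibrium (R : realType) (nu : regularity) (n m : nat)
    (S : control_affine_system R nu n m) (x0 : 'rV[R]_n) : Prop :=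
  vf S ord0 x0 = 0.

(* A curve on [0, T] is a total function whose values off [0, T] are
   irrelevant. *)
Definition abs_continuous (R : realType) (n : nat) (T : R)
    (x : R -> 'rV[R]_n) : Prop :=
  forall e : R, 0 < e -> exists2 d : R, 0 < d &
    forall (k : nat) (a b : 'I_k -> R),
      (forall i, [/\ 0 <= a i, a i < b i & b i <= T]) ->
      trivIset [set: 'I_k] (fun i => `]a i, b i[%classic) ->
      \sum_(i < k) (b i - a i) < d ->
      \sum_(i < k) enorm (x (b i) - x (a i)) < e.

(* The endpoints, where the two-sided derivative would look outside [0, T],
   form a null set. *)
Definition integral_curve (R : realType) (n : nat)
    (F : R -> 'rV[R]_n -> 'rV[R]_n) (T : R) (x : R -> 'rV[R]_n) : Prop :=
  abs_continuous T x /\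
  {ae (@lebesgue_measure R), forall t, t \in `[0, T] ->
     forall i : 'I_n,
       is_derive t 1 (fun s => x s ord0 i : R) (F t (x t) ord0 i)}.

Definition trajectory (R : realType) (nu : regularity) (n m : nat)
    (S : control_affine_system R nu n m) (T : R) (x : R -> 'rV[R]_n) : Prop :=
  exists u : R -> 'rV[R]_m,
    [/\ forall t, t \in `[0, T] -> controls S (u t),
        forall i : 'I_m, measurable_fun `[0, T] (fun t => u t ord0 i)
      & integral_curve (fun t => field_at S (u t)) T x].

Definition reachable (R : realType) (nu : regularity) (n m : nat)
    (S : control_affine_system R nu n m) (t : R) (x0 : 'rV[R]_n) :
    set 'rV[R]_n :=
  [set y | exists (T : R) (x : R -> 'rV[R]_n),
     [/\ 0 <= T <= t, trajectory S T x, x 0 = x0 & x T = y]].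

Definition growth_rate_condition (R : realType) (nu : regularity) (n m : nat)
    (S : control_affine_system R nu n m) (N : nat) (x0 : 'rV[R]_n) : Prop :=
  exists C T : R, [/\ 0 < C, 0 < T &
    forall t : R, 0 < t <= T ->
      eclosed_ball x0 (C * t ^+ N) `<=` reachable S t x0].

(* f(t) = g(t) + O(t^j) in the sense that the limit of |f(t) - g(t)| / |t|^j as
   t -> 0+ exists and is finite, which is stronger than boundedness. *)
Definition eqO_right (R : realType) (n j : nat) (f g : R -> 'rV[R]_n) : Prop :=
  exists l : R, enorm (f t - g t) / `|t| ^+ j @[t --> 0^'+] --> l.

Definition variations (R : realType) (nu : regularity) (n m : nat)
    (S : control_affine_system R nu n m) (k : nat) (x0 : 'rV[R]_n) :
    set 'rV[R]_n :=
  [set v | exists gamma : R -> 'rV[R]_n,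
     (forall t, 0 <= t -> reachable S t x0 (gamma t)) /\
     eqO_right k.+1 gamma (fun t => x0 + t ^+ k *: v)].

Definition variation_cone (R : realType) (nu : regularity) (n m : nat)
    (S : control_affine_system R nu n m) (k : nat) (x0 : 'rV[R]_n) :
    set 'rV[R]_n :=
  \bigcup_(al in [set al : R | 0 <= al]) [set al *: v | v in variations S k x0].

(* With 0-based indices, the piece j is run on the time interval
   (t_{j+1} + ... + t_{p-1}, t_j + ... + t_{p-1}], so that the last piece comes
   first; time 0 belongs to the last piece. *)
Definition piece_active (R : realType) (p : nat) (t : 'I_p -> R) (s : R)
    (j : 'I_p) : bool :=
  (\sum_(l < p | (j < l)%N) t l < s <= \sum_(l < p | (j <= l)%N) t l)
  || ((j.+1 == p) && (s == 0)).

(* Exactly one piece is active at each time in [0, t_0 + ... + t_{p-1}]. *)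
Definition piecewise_field (R : realType) (nu : regularity) (n m : nat)
    (S : control_affine_system R nu n m) (p : nat) (I : 'I_p -> 'rV[R]_m)
    (t : 'I_p -> R) (s : R) (x : 'rV[R]_n) : 'rV[R]_n :=
  \sum_(j < p | piece_active t s j) field_at S (I j) x.

Definition complete_on (R : realType) (n : nat)
    (F : R -> 'rV[R]_n -> 'rV[R]_n) (T : R) : Prop :=
  forall y : 'rV[R]_n, exists x : R -> 'rV[R]_n,
    x 0 = y /\ integral_curve F T x.

Definition standing_assumption (R : realType) (nu : regularity) (n m : nat)
    (S : control_affine_system R nu n m) : Prop :=
  (forall (p : nat) (I : 'I_p -> 'rV[R]_m) (t : 'I_p -> R),
     (0 < p)%N -> (forall j, controls S (I j)) -> (forall j, 0 < t j) ->
     complete_on (piecewise_field S I t) (\sum_(j < p) t j)) /\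
  controls S = [set u : 'rV[R]_m | forall i : 'I_m, -1 <= u ord0 i <= 1].

(* Main.v *)
(** The growth condition gives the variations [v] with [enorm v <= C] through
    the curves [x0 + t ^+ N *: v]. For the converse, no continuity of the
    variations is available, so no topological covering argument applies.
    Instead, a target [y] near [x0] is pulled back: let [r] be the modulus of
    the largest coordinate of [y - x0]. A variation in the direction of this
    coordinate is a trajectory from [x0] to a point within [O(t r)] of
    [x0 + r e], with [t ^+ N] proportional to [r]. Running its control
    backward from [y] arrives at a point whose distance to [x0] (in the
    1-norm) is smaller than that of [y] by a fixed factor, since the flow is
    [O(t)]-close to a translation. Iterating, the distances, hence also the
    durations, decay geometrically, and the concatenation of the infinitely
    many pieces is a trajectory from [x0] to [y] of duration
    [O(enorm (y - x0) `^ N^-1)]. *)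

Require Import Defs.
From HB Require Import structures.
From mathcomp Require Import all_boot all_order all_algebra.
From mathcomp Require Import all_classical all_reals all_analysis.
From mathcomp Require Import measurable_realfun ring lra.

Set Implicit Arguments.
Unset Strict Implicit.
Unset Printing Implicit Defensive.

Import Order.TTheory GRing.Theory Num.Theory.
Import numFieldNormedType.Exports.

Local Open Scope classical_set_scope.
Local Open Scope ring_scope.

(** * Absolutely continuous curves *)

(** Working backward makes the endpoint exact and moves the whole error to the starting point, where
    earlier pieces can absorb it; a forward construction would need surjectivity of an endpoint map
    with no known continuity. The 1-norm is the right gauge because cancelling a coordinate of
    modulus [r] lowers it by exactly [r], which leaves room for errors up to [r / 2]. Durations
    scale as N-th roots of distances, so their ratio [q] is taken with [q ^+ N] no smaller than the
    contraction factor of the distances, and the time budgets form a geometric series with sum [t].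
    Infinitely many pieces accumulate at the initial time, so the glued curve is controlled there by
    a Lipschitz constant common to all pieces. This constant comes from a bound on the fields near
    [x0] that is uniform over the control box, together with the fact that an absolutely continuous
    curve inherits as Lipschitz constant any bound on its almost everywhere derivative. *)

Lemma normr_le_enorm (R : realType) (n : nat) (x : 'rV[R]_n) (i : 'I_n) :
  `|x ord0 i| <= enorm x.
Proof.
rewrite -sqrtr_sqr /enorm ler_wsqrtr // (bigD1 i) //= lerDl.
by apply: sumr_ge0 => j _; exact: sqr_ge0.
Qed.

Lemma enorm_ge0 (R : realType) (n : nat) (x : 'rV[R]_n) : 0 <= enorm x.
Proof. exact: sqrtr_ge0. Qed.

Lemma enorm_le_sum (R : realType) (n : nat) (x : 'rV[R]_n) :
  enorm x <= \sum_i `|x ord0 i|.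
Proof.
have s0 : 0 <= \sum_i `|x ord0 i| by apply: sumr_ge0.
rewrite -(ger0_norm s0) -sqrtr_sqr /enorm ler_wsqrtr //.
rewrite expr2 mulr_suml; apply: ler_sum => i _.
rewrite -real_normK ?num_real // expr2 ler_wpM2l //.
by rewrite (bigD1 i) //= lerDl; apply: sumr_ge0.
Qed.

(** A step carries [P] from points at or just left of [c] to points at or just right of it. Taken at
    the supremum of the points where [P] holds, it passes that supremum unless [b] is already within
    reach. *)
Lemma real_induction (R : realType) (a b : R) (P : R -> Prop) :
  a <= b -> P a ->
  (forall c, a <= c <= b -> exists2 e, 0 < e &
     forall s t, a <= s -> c - e < s -> s <= c -> c <= t -> t < c + e ->
       t <= b -> P s -> P t) ->
  P b.
Proof.
move=> ab Pa step.
pose A : set R := [set c | a <= c <= b /\ P c].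
have Aa : A a by split; rewrite ?lexx.
have ubA : ubound A b by move=> c [/andP[]].
have supA : has_sup A by split; [exists a|exists b].
have lub : sup A <= b by apply: ge_sup => //; exists a.
have ge_a : a <= sup A by apply: ub_le_sup => //; exists b.
have [|e e0 He] := step (sup A); first by rewrite ge_a.
have [s [/andP[as_ sb] Ps] lts] := sup_adherent e0 supA.
have s_sup : s <= sup A.
  by apply: ub_le_sup; [exists b|split; rewrite ?as_].
have [bl|bl] := leP b (sup A + e / 2).
  by apply: (He s) => //; lra.
have Pt : P (sup A + e / 2) by apply: (He s) => //; lra.
have : sup A + e / 2 <= sup A.
  apply: ub_le_sup; first by exists b.
  by split => //; apply/andP; split; lra.
lra.
Qed.

Lemma is_derive_dist_le (R : realType) (f : R -> R) (t d eps : R) :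
  is_derive t 1 f d -> 0 < eps ->
  exists2 e, 0 < e &
    forall s, `|s - t| < e -> `|f s - f t| <= (`|d| + eps) * `|s - t|.
Proof.
move=> [df <-] eps0.
move: (df) => /cvg_ex[l /= cvl].
have -> : 'D_1 f t = l by apply/cvg_lim.
move/cvgrPdist_le : cvl => /(_ _ eps0)[e /= e0 He].
exists e => // s st.
have [->|snt] := eqVneq s t; first by rewrite !subrr normr0 mulr0.
have h0 : s - t != 0 by rewrite subr_eq0.
have := He (s - t); rewrite /= sub0r normrN => /(_ st h0).
rewrite [(s - t) *: 1]mulr1 subrK [_ *: _]mulrC => H.
rewrite -ler_pdivrMr ?normr_gt0// -normrV ?unitfE// -normrM.
apply: le_trans (_ : `|l| + `|l - (f s - f t) / (s - t)| <= _); last by lra.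
by have := ler_normB l (l - (f s - f t) / (s - t)); rewrite subKr.
Qed.

Lemma negligible_open_cover (R : realType) (E : set R) (d : R) :
  (@lebesgue_measure R).-negligible E -> 0 < d ->
  exists U : set R, [/\ open U, E `<=` U & (lebesgue_measure U < d%:E)%E].
Proof.
move=> [A [mA A0 EA]] d0.
have [|U [oU AU mU]] := lebesgue_regularity_outer mA _ d0.
  by rewrite [X in (X < _)%E]A0.
exists U; split => //; first exact: subset_trans AU.
apply: le_lt_trans mU.
have mUo : measurable U by exact: open_measurable.
have := measureU2 (@lebesgue_measure R) (measurableD mUo mA) mA.
by rewrite (setDKU AU) [X in (_ + X)%E]A0 adde0.
Qed.

(** Cover the exceptional null set by an open [U] of small measure and march from [a] to [b].
    Outside [U] the derivative bounds increments with slope [M + ep]; inside [U] they are recorded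
    as disjoint intervals, whose total contribution absolute continuity makes smaller than
    [eps / 2]. *)
Lemma abs_continuous_ae_derive_le (R : realType) (n : nat) (T : R)
    (x : R -> 'rV[R]_n) (i : 'I_n) (M : R) :
  0 <= M -> abs_continuous T x ->
  {ae (@lebesgue_measure R), forall t, t \in `[0, T] ->
    exists2 d, `|d| <= M & is_derive t 1 (fun s => x s ord0 i : R) d} ->
  forall a b, 0 <= a -> a <= b -> b <= T ->
    `|x b ord0 i - x a ord0 i| <= M * (b - a).
Proof.
move=> M0 acx aex a b a0 ab bT; apply/ler_addgt0Pr => eps eps0.
set f := fun s => x s ord0 i in aex *.
have eps2 : 0 < eps / 2 by lra.
pose ep := (eps / 2) / (b - a + 1).
have ba1 : 0 < b - a + 1 by lra.
have ep0 : 0 < ep by rewrite divr_gt0.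
have [d d0 Hd] := acx _ eps2.
have [U [oU EU mU]] := negligible_open_cover aex d0.
pose P c := exists s : seq (R * R),
  [/\ all (fun p => [&& a <= p.1, p.1 < p.2 & p.2 <= c]) s,
      pairwise (fun p q => p.2 <= q.1) s,
      {in s, forall p, `]p.1, p.2[ `<=` U}
    & `|f c - f a| <= (M + ep) * (c - a) + \sum_(p <- s) `|f p.2 - f p.1|].
have : P b.
  apply: (real_induction ab).
    exists [::]; split => //=.
    by rewrite big_nil !subrr normr0 mulr0 addr0.
  move=> c /andP[ac cb].
  have [Uc|Uc] := pselect (U c).
    have := open_nbhs_nbhs (conj oU Uc) => /nbhs_ballP[e /= e0 He].
    exists e => // s t as_ sc sc' ct ct' tb Ps.
    have [st|st] := leP t s.
      by have -> : t = s by apply/eqP; rewrite eq_le st (le_trans sc' ct).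
    move: Ps => [l [al pl lU lf]].
    exists (rcons l (s, t)); split.
    - rewrite all_rcons /= as_ st lexx /=.
      apply: sub_all al => p /and3P[-> -> /= h]; lra.
    - rewrite pairwise_rcons pl andbT.
      by apply: sub_all al => p /and3P[].
    - move=> p; rewrite mem_rcons in_cons => /orP[/eqP ->|/lU//].
      move=> y /=; rewrite in_itv /= => /andP[sy yt].
      by apply: He; rewrite /ball /= ltr_norml; apply/andP; split; lra.
    - rewrite -cats1 big_cat /= big_seq1 /= addrA.
      have -> : f t - f a = (f s - f a) + (f t - f s) by ring.
      apply: le_trans (ler_normD _ _) _; rewrite lerD2r.
      apply: le_trans lf _; rewrite lerD2r.
      by rewrite ler_wpM2l //; lra.
  have : ~ (~` [set t | t \in `[0, T] ->
      exists2 d0, `|d0| <= M & is_derive t 1 f d0]) c.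
    by move/EU.
  move/contrapT => /=; rewrite in_itv /= => /(_ _)[|dc dcM Hdc].
    by apply/andP; split; lra.
  have [e e0 He] := is_derive_dist_le Hdc ep0.
  exists e => // s t as_ sc sc' ct ct' tb [l [al pl lU lf]].
  exists l; split => //.
    apply: sub_all al => p /and3P[-> -> /= h]; lra.
  have h1 := He s; have h2 := He t.
  have n1 : `|s - c| = c - s by rewrite distrC ger0_norm; lra.
  have n2 : `|t - c| = t - c by rewrite ger0_norm; lra.
  rewrite n1 in h1; rewrite n2 in h2.
  have {}h1 := h1 ltac:(lra); have {}h2 := h2 ltac:(lra).
  have k1 : (`|dc| + ep) * (c - s) <= (M + ep) * (c - s).
    by apply: ler_wpM2r; lra.
  have k2 : (`|dc| + ep) * (t - c) <= (M + ep) * (t - c).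
    by apply: ler_wpM2r; lra.
  have -> : f t - f a = (f s - f a) + ((f t - f c) - (f s - f c)) by ring.
  apply: le_trans (ler_normD _ _) _.
  have := ler_normB (f t - f c) (f s - f c).
  have -> : (M + ep) * (t - a) =
      (M + ep) * (s - a) + (M + ep) * (c - s) + (M + ep) * (t - c) by ring.
  lra.
move=> [l [al pl lU lf]].
pose aa (j : 'I_(size l)) := (nth (0, 0) l j).1.
pose bb (j : 'I_(size l)) := (nth (0, 0) l j).2.
have memj (j : 'I_(size l)) : nth (0, 0) l j \in l by rewrite mem_nth.
have abj j : [/\ a <= aa j, aa j < bb j & bb j <= b].
  by move/allP : al => /(_ _ (memj j)) /and3P.
have tr : trivIset [set: 'I_(size l)] (fun j => `]aa j, bb j[%classic).
  apply/trivIsetP => j k _ _ jk.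
  wlog jk' : j k jk / (j < k)%N.
    move=> W; have [kj|kj|/val_inj e] := ltngtP j k.
    - exact: W.
    - by rewrite setIC; apply: W; rewrite // eq_sym.
    - by rewrite e eqxx in jk.
  move/(pairwiseP (0, 0)) : pl => /(_ j k (ltn_ord j) (ltn_ord k) jk') h.
  apply/seteqP; split => // y /=.
  rewrite !in_itv /= => -[/andP[_ y1] /andP[y2 _]].
  rewrite /aa /bb in y1 y2; lra.
have sm : \sum_(j < size l) (bb j - aa j) < d.
  rewrite -lte_fin; apply: le_lt_trans mU.
  have -> : ((\sum_(j < size l) (bb j - aa j))%:E =
      lebesgue_measure (\big[setU/set0]_(j < size l) `]aa j, bb j[%classic))%E.
    rewrite measure_bigsetU_ord //=.
    rewrite -sumEFin; apply: eq_bigr => j _.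
    by rewrite lebesgue_measure_itv /= lte_fin; case: (abj j) => _ -> _.
  apply: le_measure; rewrite ?inE.
  - by apply: bigsetU_measurable => j _; exact: measurable_itv.
  - exact: open_measurable.
  - apply: (big_ind (fun A => A `<=` U)) => [//|A B AU BU y|j _].
      by case=> [/AU|/BU].
    exact/lU/memj.
have := Hd _ aa bb _ tr sm; move=> /(_ _)/=.
have h : forall i0 : 'I_(size l), [/\ 0 <= aa i0, aa i0 < bb i0 & bb i0 <= T].
  by move=> j; case: (abj j) => *; split; lra.
move=> /(_ h) Hs.
have : \sum_(p <- l) `|f p.2 - f p.1| < eps / 2.
  apply: le_lt_trans Hs.
  rewrite (big_nth (0, 0)) big_mkord; apply: ler_sum => j _.
  by have := normr_le_enorm (x (bb j) - x (aa j)) i; rewrite !mxE.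
have : ep * (b - a) <= eps / 2.
  rewrite /ep mulrAC ler_pdivrMr //; nra.
rewrite mulrDl in lf; lra.
Qed.

(** The pushforward of Lebesgue measure under the shift agrees with it on half-open intervals, hence
    equals it by uniqueness. *)
Lemma negligible_translation (R : realType) (E : set R) (c : R) :
  (@lebesgue_measure R).-negligible E ->
  (@lebesgue_measure R).-negligible [set t | E (t - c)].
Proof.
move=> [A [mA A0 EA]].
pose phi : R -> measurableTypeR R := fun t => t - c.
have mphi : measurable_fun [set: R] phi.
  by apply: measurable_funB => //; exact: measurable_cst.
exists (phi @^-1` A); split.
- by rewrite -[X in measurable X]setTI; exact: mphi.
- rewrite -[RHS]A0; apply/esym.
  rewrite -[RHS]/(pushforward (@lebesgue_measure R) phi A).
  apply: lebesgue_measure_unique => //= _ [[a b] /= _ <-].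
  rewrite /pushforward.
  have -> : phi @^-1` `]a, b] = `](a + c), (b + c)]%classic.
    by apply/seteqP; split => t /=; rewrite !in_itv /= /phi; lra.
  rewrite !lebesgue_measure_itv /= !lte_fin ltrD2r -!EFinB.
  by case: ifP => // _; congr EFin; ring.
- by move=> t /EA.
Qed.

(** * Almost everywhere statements and primitives *)

Lemma ae_imply (R : realType) (P Q : R -> Prop) :
  {ae (@lebesgue_measure R), forall t, P t} -> (forall t, P t -> Q t) ->
  {ae (@lebesgue_measure R), forall t, Q t}.
Proof.
move=> [A [mA A0 PA]] H; exists A; split => //.
by move=> t /= nQ; apply: PA => /= /H.
Qed.

Lemma ae_neq (R : realType) (a : R) :
  {ae (@lebesgue_measure R), forall t : R, t != a}.
Proof.
exists [set a]; split => //; first exact: lebesgue_measure_set1.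
by move=> t /= /negP /negPn /eqP.
Qed.

Lemma ae_forall_nat (R : realType) (P : nat -> R -> Prop) :
  (forall k, {ae (@lebesgue_measure R), forall t, P k t}) ->
  {ae (@lebesgue_measure R), forall t, forall k, P k t}.
Proof.
move=> H.
have [C [mC C0 FC]] := negligible_bigcup (mu := @lebesgue_measure R) H.
exists C; split => // t /= nP; apply: FC.
apply: contrapT => nF; apply: nP => k; apply: contrapT => nPk; apply: nF.
by exists k.
Qed.

Lemma ae_and (R : realType) (P Q : R -> Prop) :
  {ae (@lebesgue_measure R), forall t, P t} ->
  {ae (@lebesgue_measure R), forall t, Q t} ->
  {ae (@lebesgue_measure R), forall t, P t /\ Q t}.
Proof.
move=> HP HQ.
have : {ae (@lebesgue_measure R), forall t, forall k : nat,
    if k == 0%N then P t else Q t}.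
  by apply: ae_forall_nat => -[|k].
by move=> /ae_imply; apply => t Ht; split; [exact: (Ht 0%N)|exact: (Ht 1%N)].
Qed.

Lemma ae_forall_ord (R : realType) (n : nat) (P : 'I_n -> R -> Prop) :
  (forall i, {ae (@lebesgue_measure R), forall t, P i t}) ->
  {ae (@lebesgue_measure R), forall t, forall i, P i t}.
Proof.
move=> H.
have : {ae (@lebesgue_measure R), forall t, forall k : nat,
    forall i : 'I_n, i = k :> nat -> P i t}.
  apply: ae_forall_nat => k; have [kn|kn] := ltnP k n.
    apply: ae_imply (H (Ordinal kn)) _ => t Pt i ik.
    by have -> : i = Ordinal kn by apply: val_inj.
  by apply: aeW => t i ik; have := ltn_ord i; rewrite ik ltnNge kn.
by move=> /ae_imply; apply => t Ht i; exact: (Ht i).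
Qed.

Definition primitive (R : realType) (h : R -> R) (s : R) : R :=
  \int[lebesgue_measure]_(r in `[0, s]) h r.

Lemma bounded_integrable_itv (R : realType) (h : R -> R) (B : R)
    (b1 b2 : bool) (a b : R) :
  measurable_fun [set: R] h -> (forall r, `|h r| <= B) ->
  (@lebesgue_measure R).-integrable
    [set` Interval (BSide b1 a) (BSide b2 b)] (EFin \o h).
Proof.
move=> mh hB; apply: measurable_bounded_integrable => //.
- rewrite [X in (X < _)%E]lebesgue_measure_itv /=.
  by case: ifP; rewrite // -EFinB ltry.
- exact: measurable_funTS.
- exists B; split; first exact: num_real.
  by move=> M BM x _; apply: le_trans (hB x) (ltW BM).
Qed.

Lemma normr_Rintegral_itv_le (R : realType) (h : R -> R) (B : R)
    (b1 b2 : bool) (a b : R) :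
  measurable_fun [set: R] h -> (forall r, `|h r| <= B) -> a <= b ->
  `|\int[lebesgue_measure]_(r in [set` Interval (BSide b1 a) (BSide b2 b)]) h r|
    <= B * (b - a).
Proof.
move=> mh hB ab.
have B0 : 0 <= B := le_trans (normr_ge0 _) (hB 0).
apply: le_trans (le_normr_Rintegral _ _) _ => //.
  exact: (bounded_integrable_itv _ _ _ _ mh hB).
have mn : measurable_fun [set: R] (fun r => `|h r|) by exact: measurableT_comp.
apply: (@le_trans _ _ (\int[lebesgue_measure]_(r in
    [set` Interval (BSide b1 a) (BSide b2 b)]) (cst B r))).
  apply: le_Rintegral => //.
  - by apply: (@bounded_integrable_itv _ _ B) => // r; rewrite normr_id.
  - apply: (@bounded_integrable_itv _ _ B); first exact: measurable_cst.
    by move=> r; rewrite ger0_norm.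
rewrite Rintegral_cst // [X in fine X]lebesgue_measure_itv /= lte_fin.
rewrite ler_wpM2l //; case: ifP => //= _; by rewrite subr_ge0.
Qed.

Lemma primitive_lipschitz (R : realType) (h : R -> R) (B s t : R) :
  measurable_fun [set: R] h -> (forall r, `|h r| <= B) -> 0 <= s -> 0 <= t ->
  `|primitive h s - primitive h t| <= B * `|s - t|.
Proof.
move=> mh hB; wlog ts : s t / t <= s => [W s0 t0|s0 t0].
  by have [/W->//|/ltW/W] := leP t s; rewrite distrC (distrC s) => ->.
rewrite /primitive Rintegral_itvB ?bnd_simp //.
  by rewrite [`|s - t|]ger0_norm ?subr_ge0 //; exact: normr_Rintegral_itv_le.
exact: (bounded_integrable_itv _ _ _ _ mh hB).
Qed.

Lemma primitive_dist_le (R : realType) (h k : R -> R) (B e s : R) :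
  measurable_fun [set: R] h -> (forall r, `|h r| <= B) ->
  measurable_fun [set: R] k -> (forall r, `|k r| <= B) ->
  (forall r, `|h r - k r| <= e) -> 0 <= s ->
  `|primitive h s - primitive k s| <= e * s.
Proof.
move=> mh hB mk kB hk s0; rewrite /primitive -RintegralB //; last 2 first.
  exact: (bounded_integrable_itv _ _ _ _ mh hB).
  exact: (bounded_integrable_itv _ _ _ _ mk kB).
rewrite -{2}[s]subr0; apply: normr_Rintegral_itv_le => //.
exact: measurable_funB.
Qed.

(** The point 0 is discarded as a null set: [primitive h] vanishes to its left, so the two-sided
    derivative there need not be [h 0]. *)
Lemma primitive_ae_derive (R : realType) (h : R -> R) (B : R) :
  measurable_fun [set: R] h -> (forall r, `|h r| <= B) ->
  {ae (@lebesgue_measure R), forall t : R, 0 <= t ->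
     is_derive t 1 (primitive h) (h t)}.
Proof.
move=> mh hB.
have inth y : (@lebesgue_measure R).-integrable
    [set` Interval (BLeft 0) (BRight y)] (EFin \o h).
  exact: (bounded_integrable_itv _ _ _ _ mh hB).
have loch : locally_integrable [set: R] h.
  split => //; first exact: openT.
  move=> K _ cK.
  have : (@lebesgue_measure R).-integrable K (EFin \o h).
    apply: measurable_bounded_integrable.
    - exact: compact_measurable.
    - exact: compact_finite_measure.
    - exact: measurable_funTS.
    - exists B; split; first exact: num_real.
      by move=> M BM x _; apply: le_trans (hB x) (ltW BM).
  by move=> /integrableP[].
have := FTC1 inth loch.
move=> /(ae_and (ae_neq 0))/ae_imply; apply => t [tn0 Ht] t0.
have [|d1 d2] := Ht; first by rewrite lte_fin lt_neqAle eq_sym tn0.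
by split => //; rewrite -derive1E.
Qed.

(** * Local Lipschitz estimates *)

(** Since each property holds for all smaller radii, the minimum of finitely many works; the default
    1 covers an empty index type. *)
Lemma finite_common_radius (R : realType) (I : finType) (P : I -> R -> Prop) :
  (forall i, exists2 r, 0 < r & forall s, 0 < s <= r -> P i s) ->
  exists2 r, 0 < r & forall i s, 0 < s <= r -> P i s.
Proof.
move=> H; have /choice[r Hr] : forall i, exists r : R,
    0 < r /\ forall s, 0 < s <= r -> P i s.
  by move=> i; have [r] := H i; exists r.
exists (\big[Num.min/1]_i r i).
  elim/big_ind : _ => // [x y x0 y0|i _]; first by rewrite lt_min x0.
  exact: (Hr i).1.
move=> i s /andP[s0 sr]; apply: (Hr i).2; rewrite s0 /=.
by apply: le_trans sr _; exact: bigmin_le.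
Qed.

Lemma normr_row_coord (R : realType) (n : nat) (x : 'rV[R]_n) (i : 'I_n) :
  `|x ord0 i| <= `|x|.
Proof.
rewrite [leRHS]/Num.Def.normr /= mx_normrE.
by apply: (@le_bigmax_cond _ _ _ _ (ord0, i) _ (fun ij => `|x ij.1 ij.2|)).
Qed.

Lemma normr_row_le (R : realType) (n : nat) (x : 'rV[R]_n) (d : R) :
  0 <= d -> (forall i, `|x ord0 i| <= d) -> `|x| <= d.
Proof.
move=> d0 H; rewrite [leLHS]/Num.Def.normr /= mx_normrE.
by apply/bigmax_leP; split => // -[i j] _ /=; rewrite ord1.
Qed.

Lemma normr_row_lt (R : realType) (n : nat) (x : 'rV[R]_n) (d : R) :
  0 < d -> (forall i, `|x ord0 i| < d) -> `|x| < d.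
Proof.
move=> d0 H; rewrite [ltLHS]/Num.Def.normr /= mx_normrE.
by apply/bigmax_ltP; split => // -[i j] _ /=; rewrite ord1.
Qed.

Lemma is_derive_line (R : realType) (n : nat) (f : 'rV[R]_n -> R)
    (p v : 'rV[R]_n) (s : R) :
  derivable f (p + s *: v) v ->
  is_derive s 1 (fun r => f (p + r *: v) : R) ('D_v f (p + s *: v)).
Proof.
have E : (fun h : R => h^-1 *: (f (p + (h *: 1 + s) *: v) - f (p + s *: v))) =
         (fun h : R => h^-1 *: (f (h *: v + (p + s *: v)) - f (p + s *: v))).
  apply/funext => h; congr (_ *: (f _ - _)).
  by rewrite [h *: 1]mulr1 scalerDl addrCA.
by move=> d; split; [rewrite /derivable /= E|rewrite /derive /= E].
Qed.

Lemma line_dist_le (R : realType) (n : nat) (f : 'rV[R]_n -> R)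
    (p v : 'rV[R]_n) (h B : R) :
  (forall s, derivable f (p + s *: v) v) ->
  (forall s : R, Num.min 0 h <= s <= Num.max 0 h ->
     `|'D_v f (p + s *: v)| <= B) ->
  `|f (p + h *: v) - f p| <= B * `|h|.
Proof.
move=> df DB.
pose g r := f (p + r *: v).
have dg (s : R) : is_derive s 1 (g : R -> R) ('D_v f (p + s *: v)).
  exact: is_derive_line.
have cg : continuous (g : R -> R).
  by move=> s; apply/differentiable_continuous/derivable1_diffP.
have g0 : g 0 = f p by rewrite /g scale0r addr0.
rewrite -[f (p + _)]/(g h) -g0.
have [h0|h0] := leP 0 h.
  have [c] := MVT_segment h0 (fun s _ => dg s) (continuous_subspaceT cg).
  rewrite in_itv /= => ch ->; rewrite subr0 normrM ler_wpM2r //.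
  by apply: DB; rewrite min_l // max_r.
have [c] := MVT_segment (ltW h0) (fun s _ => dg s) (continuous_subspaceT cg).
rewrite in_itv /= => ch E; rewrite distrC E sub0r normrM normrN ler_wpM2r //.
by apply: DB; rewrite min_r ?max_l // ltW.
Qed.

(** Change the coordinates of [y] into those of [x] one at a time, so that each increment involves a
    single partial derivative. The sup-norm ball is a box, hence contains all intermediate
    segments. *)
Lemma C1_locally_lipschitz (R : realType) (n : nat) (f : 'rV[R]_n -> R)
    (x0 : 'rV[R]_n) :
  Ck 1 f -> exists rho L : R, [/\ 0 < rho, 0 <= L & forall x y,
    `|x - x0| < rho -> `|y - x0| < rho -> `|f x - f y| <= L * `|x - y|].
Proof.
move=> [cf pf].
pose B i := `|partial i f x0| + 1.
have [|rho rho0 Hrho] := @finite_common_radius R 'I_n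
    (fun i r => forall x, `|x - x0| < r -> `|partial i f x| <= B i).
  move=> i; have [_ ci] := pf i.
  have /cvgrPdist_le := ci x0; move=> /(_ 1 ltr01) /nbhs_ballP[r /= r0 Hr].
  exists r => // s /andP[_ sr] x xs.
  have := Hr x; rewrite mx_norm_ball /ball_ /= -normrN opprB.
  move=> /(_ (lt_le_trans xs sr)) H; rewrite /B -lerBlDl; apply: le_trans H.
  by rewrite distrC; exact: lerB_dist.
have {}Hrho i x : `|x - x0| < rho -> `|partial i f x| <= B i.
  by apply: Hrho; rewrite rho0 lexx.
exists rho, (\sum_i B i).
have B0 i : 0 <= B i by apply: addr_ge0.
split => //; first by apply: sumr_ge0 => i _.
move=> x y xr yr.
have xi i : `|x ord0 i - x0 ord0 i| < rho.
  by apply: le_lt_trans xr; have := normr_row_coord (x - x0) i; rewrite !mxE.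
have yi i : `|y ord0 i - x0 ord0 i| < rho.
  by apply: le_lt_trans yr; have := normr_row_coord (y - x0) i; rewrite !mxE.
pose p k : 'rV[R]_n := \row_i (if (i < k)%N then x ord0 i else y ord0 i).
have p0 : p 0%N = y by apply/rowP => i; rewrite mxE.
have pn : p n = x by apply/rowP => i; rewrite mxE ltn_ord.
have -> : f x - f y = \sum_(k < n) (f (p k.+1) - f (p k)).
  rewrite -(big_mkord xpredT (fun k => f (p k.+1) - f (p k))).
  by rewrite telescope_sumr // p0 pn.
apply: le_trans (ler_norm_sum _ _ _) _.
rewrite mulr_suml; apply: ler_sum => k _.
have -> : p k.+1 = p k + (x ord0 k - y ord0 k) *: delta_mx ord0 k.
  apply/rowP => i; rewrite !mxE eqxx /= ltnS leq_eqVlt.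
  have [->|ik] := eqVneq i k; first by rewrite eqxx ltnn /=; lra.
  by rewrite -val_eqE /= in ik; rewrite (negbTE ik) /= mulr0 addr0.
apply: le_trans (@line_dist_le _ _ _ _ _ _ (B k) _ _) _.
- by move=> s; exact: (pf k).1.
- move=> s sh; apply: Hrho.
  apply: normr_row_lt => // i.
  rewrite !mxE eqxx /=.
  have [->|ik] := eqVneq i k.
    rewrite ltnn mulr1; move: sh (xi k) (yi k).
    rewrite !ltr_norml; case: (leP 0 (x ord0 k - y ord0 k)); lra.
  by rewrite mulr0 addr0; case: ifP.
- rewrite ler_wpM2l //.
  by have := normr_row_coord (x - y) k; rewrite !mxE.
Qed.

Lemma of_class_C1 (R : realType) (n : nat) (nu : regularity)
    (f : 'rV[R]_n -> R) : of_class nu f -> Ck 1 f.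
Proof.
have Cle k g : Ck k.+1 g -> @Ck R n 1 g.
  case: k => [//|k] [cg pg]; split => // i; have [d [c _]] := pg i.
  by split.
case: nu => [[//|k] _|h|[h _]] /=; first exact: Cle.
all: exact: (h 1%N).
Qed.

(** * Backward Picard iteration *)

Lemma le_geometric_le0 (R : realType) (a c : R) :
  (forall k : nat, a <= c / 2 ^+ k) -> a <= 0.
Proof.
move=> H; have c0 : a <= c by have := H 0%N; rewrite expr0 divr1.
have [//|a0] := leP a 0.
have [k ck] : exists k : nat, c / a < k%:R.
  exists (Num.bound (c / a)); apply: archi_boundP.
  by rewrite divr_ge0 ?ltW //; lra.
have : k%:R <= 2 ^+ k :> R.
  by rewrite -natrX ler_nat ltnW // ltn_expl.
have := H k; rewrite ler_pdivlMr ?exprn_gt0 // mulrC -ler_pdivlMr //.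
lra.
Qed.

(** The radius [r k] is the sum of the remaining step bounds, so the intervals with centre [u k] and
    radius [r k] are nested, and the supremum of their left ends lies in all of them. *)
Lemma geometric_cauchy_limit (R : realType) (u : nat -> R) (c : R) :
  (forall k, `|u k.+1 - u k| <= c / 2 ^+ k) ->
  exists l, forall k, `|u k - l| <= 2 * c / 2 ^+ k.
Proof.
move=> H.
pose r k := 2 * c / 2 ^+ k.
have rS k : r k.+1 = r k - c / 2 ^+ k.
  by rewrite /r exprS; field; apply: lt0r_neq0; rewrite exprn_gt0.
have r0 k : 0 <= r k.
  by have := le_trans (normr_ge0 _) (H k); rewrite /r -mulrA; lra.
have inc : {homo (fun k => u k - r k) : j k / (j <= k)%N >-> j <= k}.
  apply: homo_leq => // [a b c'|k]; first exact: le_trans.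
  by have := H k; rewrite ler_norml rS; lra.
have dec : {homo (fun k => - (u k + r k)) : j k / (j <= k)%N >-> j <= k}.
  apply: homo_leq => // [a b c'|k]; first exact: le_trans.
  by have := H k; rewrite ler_norml rS; lra.
have ab j k : u j - r j <= u k + r k.
  have := inc j (maxn j k) (leq_maxl _ _).
  have := dec k (maxn j k) (leq_maxr _ _).
  by have := r0 (maxn j k); lra.
pose A := range (fun k => u k - r k).
exists (sup A) => k; rewrite -/(r k).
have h1 : u k - r k <= sup A.
  by apply: ub_le_sup; [exists (u 0%N + r 0%N) => _ [j _ <-]|exists k].
have h2 : sup A <= u k + r k.
  by apply: ge_sup => [|_ [j _ <-]//]; exists (u 0%N - r 0%N), 0%N.
by rewrite ler_norml; apply/andP; split; lra.
Qed.

Section picard.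
Context (R : realType) (n : nat) (T L : R) (G : R -> 'rV[R]_n -> 'rV[R]_n).
Context (delta : 'rV[R]_n).
Hypothesis T0 : 0 <= T.
Hypothesis L0 : 0 <= L.
Hypothesis LT : L * T <= 1 / 4.
Hypothesis Glip : forall (r : R) (v w : 'rV[R]_n), 0 <= r <= T ->
  `|v| <= 2 * `|delta| -> `|w| <= 2 * `|delta| ->
  forall i, `|G r v ord0 i - G r w ord0 i| <= L * `|v - w|.
Hypothesis G0 : forall r : R, 0 <= r <= T -> G r 0 = 0.
Hypothesis Gmeas : forall (w : R -> 'rV[R]_n) (K : R),
  (forall s t : R, 0 <= s <= T -> 0 <= t <= T ->
     `|w s - w t| <= K * `|s - t|) ->
  forall i, measurable_fun `[0, T] (fun r => G r (w r) ord0 i).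

Local Notation B := (2 * L * `|delta|).

(** A class of curves stable under [Phi]: on it [G] is at most [L * (2 * |delta|) = B], and
    [B * T <= |delta|] keeps [Phi w] within [2 * |delta|]. *)
Let admissible (w : R -> 'rV[R]_n) :=
  (forall s t : R, 0 <= s <= T -> 0 <= t <= T ->
     `|w s - w t| <= B * `|s - t|) /\
  (forall s : R, 0 <= s <= T -> `|w s| <= 2 * `|delta|).

Let h (w : R -> 'rV[R]_n) i := (fun r => G r (w r) ord0 i) \_ `[0, T].

(** The integral operator of the problem with value [delta] at the final time [T], written with
    primitives based at 0. *)
Let Phi w s : 'rV[R]_n :=
  \row_i (delta ord0 i + (primitive (h w i) s - primitive (h w i) T)).

Let B0 : 0 <= B. Proof. by rewrite !mulr_ge0. Qed.

Let hin w i r : 0 <= r <= T -> h w i r = G r (w r) ord0 i.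
Proof. by move=> rT; rewrite /h patchE mem_set //= in_itv /= rT. Qed.

Let hout w i r : ~~ (0 <= r <= T) -> h w i r = 0.
Proof.
by move=> rT; rewrite /h patchE memNset //= in_itv /=; exact/negP.
Qed.

Let hmeas w : admissible w -> forall i, measurable_fun [set: R] (h w i).
Proof.
move=> [wl _] i; apply/(measurable_restrictT _ _).1 => //.
exact: Gmeas wl i.
Qed.

Let hB w : admissible w -> forall i r, `|h w i r| <= B.
Proof.
move=> [_ wb] i r; have [rT|rT] := boolP (0 <= r <= T); last first.
  by rewrite hout // normr0.
rewrite hin //.
have := @Glip r (w r) 0 rT (wb r rT) _ i; rewrite G0 // mxE !subr0 normr0.
move=> /(_ (mulr_ge0 _ (normr_ge0 _))) H; apply: le_trans (H _) _ => //.
have -> : B = L * (2 * `|delta|) by ring.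
by rewrite ler_wpM2l //; exact: wb.
Qed.

Let hdist v w e : admissible v -> admissible w -> 0 <= e ->
  (forall s : R, 0 <= s <= T -> `|v s - w s| <= e) ->
  forall i r, `|h v i r - h w i r| <= L * e.
Proof.
move=> [_ vb] [_ wb] e0 vw i r; have [rT|rT] := boolP (0 <= r <= T); last first.
  by rewrite !hout // subrr normr0 mulr_ge0.
rewrite !hin //; apply: le_trans (Glip rT (vb _ rT) (wb _ rT) i) _.
by rewrite ler_wpM2l // vw.
Qed.

Let PhiT w : Phi w T = delta.
Proof. by apply/rowP => i; rewrite mxE subrr addr0. Qed.

Let Phi_lip w s t : admissible w -> 0 <= s <= T -> 0 <= t <= T ->
  `|Phi w s - Phi w t| <= B * `|s - t|.
Proof.
move=> aw /andP[s0 _] /andP[t0 _]; apply: normr_row_le; first exact: mulr_ge0.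
move=> i; rewrite !mxE.
have -> : forall a b c d : R, a + (b - c) - (a + (d - c)) = b - d.
  by move=> *; ring.
by apply: primitive_lipschitz => //; [exact: hmeas|exact: hB].
Qed.

Let BT : B * T <= `|delta|.
Proof.
have -> : B * T = 2 * (L * T) * `|delta| by ring.
by apply: ler_piMl => //; have LT' := LT; lra.
Qed.

Let Phi_delta w s : admissible w -> 0 <= s <= T ->
  `|Phi w s - delta| <= B * T.
Proof.
move=> aw sT; rewrite -[X in _ - X](PhiT w).
apply: le_trans (Phi_lip aw sT _) _; first by rewrite T0 lexx.
rewrite ler_wpM2l // ler_norml; lra.
Qed.

Let Phi_admissible w : admissible w -> admissible (Phi w).
Proof.
move=> aw; split => [s t sT tT|s sT]; first exact: Phi_lip.
have := ler_normD (Phi w s - delta) delta; rewrite subrK.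
by have := Phi_delta aw sT; have := BT; lra.
Qed.

(** The primitives at [s] and at [T] each contribute at most [L * T * e], and [L * T <= 1 / 4]. *)
Let Phi_dist v w e : admissible v -> admissible w ->
  (forall s : R, 0 <= s <= T -> `|v s - w s| <= e) ->
  forall s : R, 0 <= s <= T -> `|Phi v s - Phi w s| <= e / 2.
Proof.
move=> av aw vw s sT.
have e0 : 0 <= e := le_trans (normr_ge0 _) (vw s sT).
apply: normr_row_le; first by rewrite divr_ge0.
move=> i; rewrite !mxE.
have -> : forall a b c d e : R, a + (b - c) - (a + (d - e)) = (b - d) - (c - e).
  by move=> *; ring.
have Hs t : 0 <= t <= T ->
    `|primitive (h v i) t - primitive (h w i) t| <= e / 4.
  move=> /andP[t0 tT].
  apply: le_trans (primitive_dist_le (hmeas av i) (hB av i) (hmeas aw i)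
    (hB aw i) (hdist av aw e0 vw i) t0) _.
  have := ler_wpM2l (mulr_ge0 L0 e0) tT; have := ler_wpM2r e0 LT.
  lra.
apply: le_trans (ler_normB _ _) _.
have := Hs s sT; have := Hs T; rewrite T0 lexx => /(_ isT); lra.
Qed.

Let wseq k := iter k Phi (fun=> delta).

Let wseq_admissible k : admissible (wseq k).
Proof.
elim: k => [|k IH]; last exact: Phi_admissible.
split => [s t _ _|s _]; first by rewrite subrr normr0 mulr_ge0.
by rewrite /=; have := normr_ge0 delta; lra.
Qed.

Let wseq_dist k s : 0 <= s <= T ->
  `|wseq k.+1 s - wseq k s| <= `|delta| / 2 ^+ k.
Proof.
elim: k s => [|k IH] s sT.
  rewrite expr0 divr1; apply: le_trans BT.
  exact: (Phi_delta (wseq_admissible 0)).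
have := Phi_dist (wseq_admissible k.+1) (wseq_admissible k) IH sT.
by rewrite exprS invfM mulrA (mulrAC _ 2^-1).
Qed.

(** To be applied with [G t v] the difference of the fields at [x t + v] and at [x t], so that [w]
    is the displacement between two trajectories with the same control. *)
Lemma picard_backward : exists w : R -> 'rV[R]_n, [/\ w T = delta,
  (forall s : R, 0 <= s <= T -> `|w s - delta| <= 2 * L * T * `|delta|),
  (forall s t : R, 0 <= s <= T -> 0 <= t <= T ->
     `|w s - w t| <= 2 * L * `|delta| * `|s - t|) &
  {ae (@lebesgue_measure R), forall t : R, 0 <= t <= T -> forall i,
     is_derive t 1 (fun s => w s ord0 i : R) (G t (w t) ord0 i)}].
Proof.
have /choice[w Hw] : forall s, exists l : 'rV[R]_n, 0 <= s <= T ->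
    forall k, `|wseq k s - l| <= 2 * `|delta| / 2 ^+ k.
  move=> s; have [sT|sT] := boolP (0 <= s <= T); last by exists 0.
  have /choice[l Hl] : forall i : 'I_n, exists l : R, forall k,
      `|wseq k s ord0 i - l| <= 2 * `|delta| / 2 ^+ k.
    move=> i; apply: geometric_cauchy_limit => k.
    apply: le_trans (wseq_dist k sT).
    by have := normr_row_coord (wseq k.+1 s - wseq k s) i; rewrite !mxE.
  exists (\row_i l i) => _ k; apply: normr_row_le.
    by rewrite divr_ge0 ?mulr_ge0 // exprn_ge0.
  by move=> i; rewrite !mxE.
have aw : admissible w.
  split => [s t sT tT|s sT]; rewrite -subr_le0.
    apply: (@le_geometric_le0 _ _ (4 * `|delta|)) => k.
    have [H1 _] := wseq_admissible k.
    have := H1 s t sT tT; have := Hw t tT k; have := Hw s sT k.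
    rewrite [X in X <= _ -> _]distrC.
    have := ler_distD (wseq k s) (w s) (w t).
    have := ler_distD (wseq k t) (wseq k s) (w t).
    lra.
  apply: (@le_geometric_le0 _ _ (2 * `|delta|)) => k.
  have [_ H1] := wseq_admissible k.
  have := H1 s sT; have := Hw s sT k; rewrite [X in X <= _ -> _]distrC.
  by have := ler_distD (wseq k s) (w s) 0; rewrite !subr0; lra.
have Phiw s : 0 <= s <= T -> Phi w s = w s.
  move=> sT; apply/eqP; rewrite -subr_eq0 -normr_le0.
  apply: (@le_geometric_le0 _ _ (2 * `|delta|)) => k.
  have ww r : 0 <= r <= T -> `|w r - wseq k r| <= 2 * `|delta| / 2 ^+ k.
    by move=> rT; rewrite distrC; exact: Hw.
  have := Phi_dist aw (wseq_admissible k) ww sT.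
  have := Hw s sT k.+1; have := ler_distD (wseq k.+1 s) (Phi w s) (w s).
  rewrite exprS invfM -[wseq k.+1 s]/(Phi (wseq k) s).
  by move: (2 ^+ k)^-1 => q; lra.
(* [w] and [Phi w] are known to agree on [[0, T]] only. Each coordinate of [Phi w] is a primitive
   plus a constant on the whole line, which yields the two-sided derivatives. *)
exists (Phi w); split => //.
- by move=> s sT; rewrite mulrAC; exact: Phi_delta.
- by move=> s t sT tT; exact: Phi_lip.
have Hae i : {ae (@lebesgue_measure R), forall t : R, 0 <= t ->
    is_derive t 1 (primitive (h w i)) (h w i t)}.
  by apply: primitive_ae_derive; [exact: hmeas|exact: hB].
have : {ae (@lebesgue_measure R), forall t : R, forall i, 0 <= t ->
    is_derive t 1 (primitive (h w i)) (h w i t)}.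
  exact: ae_forall_ord.
move=> /ae_imply; apply => t Ht tT i.
rewrite Phiw // -hin //.
have -> : (fun s => Phi w s ord0 i : R) =
    (primitive (h w i) + cst (delta ord0 i - primitive (h w i) T)).
  by apply/funext => s; rewrite mxE addrCA.
apply: is_derive_eq; last exact: addr0.
by apply: is_deriveD; apply: Ht; case/andP: tT.
Qed.
End picard.

(** * Trajectories near a point *)

(** The radius refers to the sup norm. One [L] and one [M] serve all admissible controls, so that
    all pieces of a concatenation share them. *)
Definition field_bounds (R : realType) (nu : regularity) (n m : nat)
    (S : control_affine_system R nu n m) (x0 : 'rV[R]_n) (rho L M : R) : Prop :=
  (forall u x y, controls S u -> `|x - x0| < rho -> `|y - x0| < rho ->
     forall i, `|field_at S u x ord0 i - field_at S u y ord0 i|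
               <= L * `|x - y|) /\
  (forall u x, controls S u -> `|x - x0| < rho ->
     forall i, `|field_at S u x ord0 i| <= M).

Lemma field_atE (R : realType) (nu : regularity) (n m : nat)
    (S : control_affine_system R nu n m) u x i :
  field_at S u x ord0 i = vf S ord0 x ord0 i +
    \sum_(k < m) u ord0 k * vf S (lift ord0 k) x ord0 i.
Proof.
by rewrite !mxE summxE; congr (_ + _); apply: eq_bigr => k _; rewrite mxE.
Qed.

Lemma box_combination_le (R : realType) (m : nat) (u : 'rV[R]_m)
    (c : 'I_m.+1 -> R) :
  (forall k, -1 <= u ord0 k <= 1) ->
  `|c ord0 + \sum_(k < m) u ord0 k * c (lift ord0 k)| <= \sum_j `|c j|.
Proof.
move=> u1; rewrite big_ord_recl; apply: le_trans (ler_normD _ _) _.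
rewrite lerD2l; apply: le_trans (ler_norm_sum _ _ _) _.
apply: ler_sum => k _; rewrite normrM ler_piMl // ler_norml; exact: u1.
Qed.

Lemma field_bounds_exist (R : realType) (nu : regularity) (n m : nat)
    (S : control_affine_system R nu n m) (x0 : 'rV[R]_n) :
  controls S = [set u : 'rV[R]_m | forall i : 'I_m, -1 <= u ord0 i <= 1] ->
  exists rho L M, [/\ 0 < rho, 0 <= L, 0 <= M & field_bounds S x0 rho L M].
Proof.
move=> hC.
have [|rho rho0 Hrho] := @finite_common_radius R ('I_m.+1 * 'I_n)%type
  (fun p r => exists2 L : R, 0 <= L & forall x y,
    `|x - x0| < r -> `|y - x0| < r ->
    `|vf S p.1 x ord0 p.2 - vf S p.1 y ord0 p.2| <= L * `|x - y|).
  move=> [j i] /=.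
  have [r [L [r0 L0 H]]] :=
    C1_locally_lipschitz x0 (of_class_C1 (vf_class S j i)).
  exists r => // s /andP[_ sr]; exists L => // x y xs ys.
  by apply: H; exact: lt_le_trans sr.
have /choice[Lp HL] : forall p : 'I_m.+1 * 'I_n, exists L : R, 0 <= L /\
    forall x y, `|x - x0| < rho -> `|y - x0| < rho ->
    `|vf S p.1 x ord0 p.2 - vf S p.1 y ord0 p.2| <= L * `|x - y|.
  move=> p; have [|L L0 H] := Hrho p rho; first by rewrite rho0 lexx.
  by exists L.
pose La := \sum_p Lp p.
have Lap p : Lp p <= La.
  by rewrite /La (bigD1 p) //= lerDl; apply: sumr_ge0 => q _; exact: (HL q).1.
have La0 : 0 <= La by apply: sumr_ge0 => q _; exact: (HL q).1.
pose K := \sum_(p : 'I_m.+1 * 'I_n) `|vf S p.1 x0 ord0 p.2|.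
have Kp j i : `|vf S j x0 ord0 i| <= K.
  by rewrite /K (bigD1 (j, i)) //= lerDl; apply: sumr_ge0.
have K0 : 0 <= K by apply: sumr_ge0.
pose L := m.+1%:R * La.
have L0 : 0 <= L by rewrite mulr_ge0.
have lip u x y : controls S u -> `|x - x0| < rho -> `|y - x0| < rho ->
     forall i, `|field_at S u x ord0 i - field_at S u y ord0 i|
               <= L * `|x - y|.
  rewrite hC /= => hu xr yr i; rewrite !field_atE.
  pose c j := vf S j x ord0 i - vf S j y ord0 i.
  rewrite [X in `|X|](_ : _ =
      c ord0 + \sum_(k < m) u ord0 k * c (lift ord0 k)); last first.
    rewrite /c opprD addrACA; congr (_ + _); rewrite -sumrB.
    by apply: eq_bigr => k _; rewrite mulrBr.
  apply: le_trans (box_combination_le _ hu) _.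
  apply: le_trans (_ : \sum_(j < m.+1) La * `|x - y| <= _).
    apply: ler_sum => j _.
    apply: le_trans ((HL (j, i)).2 x y xr yr) _.
    by rewrite ler_wpM2r.
  by rewrite sumr_const card_ord /L -mulrA mulr_natl.
exists rho, L, (L * rho + m.+1%:R * K); split => //.
  by rewrite addr_ge0 // mulr_ge0 // ltW.
split => // u x hu xr i.
have x0r : `|x0 - x0| < rho by rewrite subrr normr0.
have h1 := lip u x x0 hu xr x0r i.
have h2 : L * `|x - x0| <= L * rho by rewrite ler_wpM2l // ltW.
have h3 : `|field_at S u x0 ord0 i| <= m.+1%:R * K.
  rewrite field_atE.
  rewrite hC /= in hu.
  apply: le_trans (@box_combination_le _ _ _ (fun j => vf S j x0 ord0 i) hu) _.
  apply: le_trans (_ : \sum_(j < m.+1) K <= _); first exact: ler_sum.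
  by rewrite sumr_const card_ord mulr_natl.
have := ler_normD (field_at S u x ord0 i - field_at S u x0 ord0 i)
  (field_at S u x0 ord0 i).
by rewrite subrK; lra.
Qed.

Lemma normr_le_enorm_row (R : realType) (n : nat) (x : 'rV[R]_n) :
  `|x| <= enorm x.
Proof.
apply: normr_row_le; first exact: enorm_ge0.
by move=> i; exact: normr_le_enorm.
Qed.

Lemma enorm_le_normr (R : realType) (n : nat) (x : 'rV[R]_n) :
  enorm x <= n%:R * `|x|.
Proof.
apply: le_trans (enorm_le_sum _) _.
apply: le_trans (_ : \sum_(i < n) `|x| <= _).
  by apply: ler_sum => i _; exact: normr_row_coord.
by rewrite sumr_const card_ord mulr_natl.
Qed.

Lemma abs_continuous_uniform (R : realType) (n : nat) (T : R)
    (x : R -> 'rV[R]_n) (e : R) :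
  abs_continuous T x -> 0 < e ->
  exists2 d, 0 < d & forall s t, 0 <= s <= T -> 0 <= t <= T ->
    `|s - t| < d -> `|x s - x t| < e.
Proof.
move=> acx e0; have [d d0 Hd] := acx e e0; exists d => //.
move=> s t; wlog st : s t / s < t.
  move=> W sT tT; have [st|ts|->] := ltgtP s t.
  - exact: W.
  - by rewrite distrC (distrC (x s)); exact: W.
  - by rewrite !subrr !normr0.
move=> sT tT std; rewrite distrC; apply: le_lt_trans (normr_le_enorm_row _) _.
have := Hd 1%N (fun=> s) (fun=> t).
rewrite !big_ord_recl !big_ord0 !addr0; apply.
- by move=> _; split; lra.
- by apply/trivIsetP => i j _ _; rewrite !ord1 eqxx.
- by rewrite distrC ger0_norm in std; lra.
Qed.

Lemma lipschitz_abs_continuous (R : realType) (n : nat) (T K : R)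
    (x : R -> 'rV[R]_n) :
  0 <= K ->
  (forall s t, 0 <= s <= T -> 0 <= t <= T -> `|x s - x t| <= K * `|s - t|) ->
  abs_continuous T x.
Proof.
move=> K0 lip e e0.
have nK : 0 < n%:R * K + 1 by apply: ltr_wpDl => //; rewrite mulr_ge0.
exists (e / (n%:R * K + 1)); first by rewrite divr_gt0.
move=> k a b ab _ sd.
apply: le_lt_trans (_ : (n%:R * K + 1) * \sum_(i < k) (b i - a i) < _);
  last first.
  by rewrite mulrC -ltr_pdivlMr.
rewrite mulr_sumr; apply: ler_sum => i _; have [a0 aib bT] := ab i.
apply: le_trans (enorm_le_normr _) _.
have := lip (b i) (a i); rewrite (@ger0_norm _ (b i - a i)); last by lra.
move=> /(_ ltac:(lra) ltac:(lra)) h.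
have := ler_wpM2l (ler0n R n) h; lra.
Qed.

Lemma abs_continuous_le (R : realType) (n : nat) (T c : R)
    (x : R -> 'rV[R]_n) : c <= T -> abs_continuous T x -> abs_continuous c x.
Proof.
move=> cT acx e e0; have [d d0 H] := acx e e0; exists d => // k a b ab.
by apply: H => i; have [? ? ?] := ab i; split=> //; lra.
Qed.

(** The intermediate time [c] allows use before the trajectory is known to stay in the ball up to
    [T]. *)
Lemma trajectory_lipschitz (R : realType) (nu : regularity) (n m : nat)
    (S : control_affine_system R nu n m) (x0 : 'rV[R]_n) (rho L M T c : R)
    (x : R -> 'rV[R]_n) :
  field_bounds S x0 rho L M -> 0 <= M -> trajectory S T x -> c <= T ->
  (forall s, 0 <= s <= c -> `|x s - x0| < rho) ->
  forall s t, 0 <= s <= c -> 0 <= t <= c -> `|x s - x t| <= M * `|s - t|.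
Proof.
move=> [_ HM] M0 [u [uC _ [acx aex]]] cT xr s t.
wlog ts : s t / t <= s.
  move=> W sc tc; have [|/ltW] := leP t s; first by move/W; exact.
  by rewrite distrC (distrC s) => /W; exact.
move=> sc tc; apply: normr_row_le; first by rewrite mulr_ge0.
move=> i; rewrite !mxE (@ger0_norm _ (s - t)); last by lra.
apply: (abs_continuous_ae_derive_le (T := c)) => //; try lra.
  exact: abs_continuous_le acx.
apply: ae_imply aex _ => r Hr; rewrite in_itv /= => rc.
have rT : r \in `[0, T] by rewrite in_itv /=; lra.
exists (field_at S (u r) (x r) ord0 i); last exact: Hr.
by apply: HM; [exact: uC|exact: xr].
Qed.

(** Bootstrap: while the curve stays in the ball it moves by at most [M * T], and the gap
    [rho - M * T] lets uniform continuity carry it on for a further fixed time. *)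
Lemma trajectory_confined (R : realType) (nu : regularity) (n m : nat)
    (S : control_affine_system R nu n m) (x0 : 'rV[R]_n) (rho L M T : R)
    (x : R -> 'rV[R]_n) :
  field_bounds S x0 rho L M -> 0 <= M -> trajectory S T x -> 0 <= T ->
  M * T < rho -> x 0 = x0 ->
  forall s, 0 <= s <= T -> `|x s - x0| <= M * s.
Proof.
move=> fb M0 tx T0 MT x00.
have rho0 : 0 < rho by apply: le_lt_trans MT; rewrite mulr_ge0.
have [u [_ _ [acx _]]] := tx.
have e0 : 0 < rho - M * T by lra.
have [d d0 Hd] := abs_continuous_uniform acx e0.
have bound c : 0 <= c <= T -> (forall s, 0 <= s <= c -> `|x s - x0| < rho) ->
    forall s, 0 <= s <= c -> `|x s - x0| <= M * s.
  move=> cT H s sc.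
  have := trajectory_lipschitz fb M0 tx (c := c) ltac:(lra) H sc
    (t := 0) ltac:(lra).
  by rewrite x00 subr0 (@ger0_norm _ s); lra.
have : forall s, 0 <= s <= T -> `|x s - x0| < rho.
  apply: (@real_induction R 0 T
    (fun c => forall s, 0 <= s <= c -> `|x s - x0| < rho)) => //.
    move=> s s0; have -> : s = 0 by lra.
    by rewrite x00 subrr normr0.
  move=> c cT; exists (d / 2); first by rewrite divr_gt0.
  move=> s t s0 cs sc ct tc tT Ps r rt.
  have [rs|rs] := leP r s; first by apply: Ps; lra.
  have h1 := bound s ltac:(lra) Ps s ltac:(lra).
  have h2 : `|x r - x s| < rho - M * T.
    by apply: Hd; [lra|lra|rewrite ger0_norm; lra].
  have h3 := ler_distD (x s) (x r) x0.
  have h4 : M * s <= M * T by rewrite ler_wpM2l //; lra.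
  lra.
by move=> H; apply: bound => //; rewrite T0 lexx.
Qed.

(** Extending a curve on [[0, T]] by its end values makes it continuous on the line, so that its
    composition with a continuous field is measurable. *)
Lemma clamp_continuous (R : realType) (n : nat) (T : R) (x : R -> 'rV[R]_n) :
  0 <= T ->
  (forall e : R, 0 < e -> exists2 d : R, 0 < d & forall s t : R,
     0 <= s <= T -> 0 <= t <= T -> `|s - t| < d -> `|x s - x t| < e) ->
  continuous (fun t => x (Num.max 0 (Num.min t T))).
Proof.
move=> T0 ucx t; apply/cvgrPdist_lt => e e0.
have [d d0 Hd] := ucx e e0.
near=> s; apply: Hd.
- by rewrite le_max lexx /= ge_max T0 ge_min lexx orbT.
- by rewrite le_max lexx /= ge_max T0 ge_min lexx orbT.
- have : `|t - s| < d by near: s; exact: cvgr_dist_lt.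
  apply: le_lt_trans; rewrite ler_norml.
  have := ler_norm (t - s); have := ler_norm (s - t); rewrite (distrC s).
  case: (leP s T) => ?; case: (leP t T) => ?.
  all: case: (leP 0 s) => ?; case: (leP 0 t) => ?; case: (leP 0 T) => ?; lra.
Unshelve. all: by end_near. Qed.

Lemma field_measurable (R : realType) (nu : regularity) (n m : nat)
    (S : control_affine_system R nu n m) (T : R) (u : R -> 'rV[R]_m)
    (z : R -> 'rV[R]_n) :
  0 <= T ->
  (forall k, measurable_fun `[0, T] (fun t => u t ord0 k)) ->
  (forall e : R, 0 < e -> exists2 d : R, 0 < d & forall s t : R,
     0 <= s <= T -> 0 <= t <= T -> `|s - t| < d -> `|z s - z t| < e) ->
  forall i, measurable_fun `[0, T] (fun t => field_at S (u t) (z t) ord0 i).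
Proof.
move=> T0 mu ucz i.
have mvf j : measurable_fun `[0, T] (fun t => vf S j (z t) ord0 i).
  have mf : measurable_fun `[0, T]
      (fun t : R => vf S j (z (Num.max 0 (Num.min t T))) ord0 i).
    apply: measurable_funTS; apply: continuous_measurable_fun => t.
    have [cv _] := of_class_C1 (vf_class S j i).
    apply: (@continuous_comp _ _ _ (fun t => z (Num.max 0 (Num.min t T)))
      (fun x => vf S j x ord0 i)); last exact: cv.
    exact: clamp_continuous.
  apply: eq_measurable_fun mf => t.
  rewrite inE /= in_itv /= => /andP[t0 tT].
  by rewrite min_l // max_r.
have mf : measurable_fun `[0, T] (fun t => vf S ord0 (z t) ord0 i +
    \sum_(k < m) u t ord0 k * vf S (lift ord0 k) (z t) ord0 i).
  apply: measurable_funD => //; apply: measurable_sum => k.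
  exact: measurable_funM.
by apply: eq_measurable_fun mf => t _; rewrite field_atE.
Qed.

(** Seek [z = x + w] with the same control: [w] follows a field that vanishes at 0 and is
    [L]-Lipschitz, so it varies by at most [2 * L * T * |y - x T|]. The smallness conditions keep
    [x] within [rho / 2] of [x0] and [w] within [rho / 2] of 0. *)
Lemma trajectory_pullback (R : realType) (nu : regularity) (n m : nat)
    (S : control_affine_system R nu n m) (x0 y : 'rV[R]_n) (rho L M T : R)
    (x : R -> 'rV[R]_n) :
  field_bounds S x0 rho L M -> 0 <= L -> 0 <= M -> 0 <= T ->
  L * T <= 1 / 4 -> 2 * (M * T) < rho -> trajectory S T x -> x 0 = x0 ->
  4 * `|y - x T| <= rho ->
  exists z, [/\ trajectory S T z, z T = y,
    `|z 0 - x0 - (y - x T)| <= 2 * L * T * `|y - x T| &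
    forall s t, 0 <= s <= T -> 0 <= t <= T -> `|z s - z t| <= M * `|s - t|].
Proof.
move=> fb L0 M0 T0 LT MT tx x00 yr.
have MT0 : 0 <= M * T by rewrite mulr_ge0.
have xr s : 0 <= s <= T -> 2 * `|x s - x0| < rho.
  move=> sT; have := trajectory_confined fb M0 tx T0 ltac:(lra) x00 sT.
  have : M * s <= M * T by rewrite ler_wpM2l //; lra.
  by have := normr_ge0 (x s - x0); lra.
have xlip := trajectory_lipschitz fb M0 tx (lexx T)
  (fun s sT => ltac:(have := xr s sT; have := normr_ge0 (x s - x0); lra)).
set delta := y - x T in yr *.
have [u [uC um [acx aex]]] := tx.
pose G r v := field_at S (u r) (x r + v) - field_at S (u r) (x r).
have uin r : 0 <= r <= T -> controls S (u r).
  by move=> rT; apply: uC; rewrite in_itv.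
have inball r v : 0 <= r <= T -> `|v| <= 2 * `|delta| -> `|x r + v - x0| < rho.
  move=> rT vd; have := ler_normD (x r - x0) v; rewrite addrAC.
  by have := xr r rT; lra.
have := @picard_backward R n T L G delta T0 L0 LT; case.
- move=> r v w rT vd wd i; rewrite !mxE opprB addrA subrK.
  have -> : v - w = (x r + v) - (x r + w) by rewrite opprD addrACA subrr add0r.
  have := fb.1 (u r) (x r + v) (x r + w) (uin r rT) (inball r v rT vd)
    (inball r w rT wd) i.
  by rewrite !mxE.
- by move=> r _; rewrite /G addr0 subrr.
- move=> w K wK i.
  have ucx e : 0 < e -> _ := @abs_continuous_uniform _ _ T x e acx.
  have ucxw e : 0 < e -> exists2 d : R, 0 < d & forall s t : R,
      0 <= s <= T -> 0 <= t <= T -> `|s - t| < d ->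
      `|x s + w s - (x t + w t)| < e.
    have K1 : 0 < `|K| + 1 by rewrite ltr_wpDl.
    have K2 : 0 < M + `|K| + 1 by have := normr_ge0 K; lra.
    move=> e0; exists (e / (M + `|K| + 1)); first by rewrite divr_gt0.
    move=> s t sT tT; rewrite ltr_pdivlMr // => st.
    have := xlip s t sT tT; have := wK s t sT tT.
    have := ler_normD (x s - x t) (w s - w t); rewrite addrACA -opprD.
    have := ler_wpM2r (normr_ge0 (s - t)) (ler_norm K).
    have := normr_ge0 (s - t); lra.
  have mf : measurable_fun `[0, T] (fun r =>
      field_at S (u r) (x r + w r) ord0 i - field_at S (u r) (x r) ord0 i).
    by apply: measurable_funB; apply: field_measurable.
  by apply: eq_measurable_fun mf => r _; rewrite !mxE.
move=> w [wT wd wl aew].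
have w2 s : 0 <= s <= T -> `|w s| <= 2 * `|delta|.
  move=> sT; have := wd s sT; have := ler_normD (w s - delta) delta.
  rewrite subrK; have := ler_wpM2r (normr_ge0 delta) LT.
  by have := normr_ge0 delta; lra.
have tz : trajectory S T (fun s => x s + w s).
  exists u; split => //; split.
    apply: (@lipschitz_abs_continuous _ _ _ (M + 2 * L * `|delta|)).
      by rewrite addr_ge0 // !mulr_ge0.
    move=> s t sT tT; rewrite opprD addrACA mulrDl.
    by apply: le_trans (ler_normD _ _) _; rewrite lerD // ?xlip ?wl.
  apply: ae_imply (ae_and aex aew) _ => t [Hx Hw] tT i.
  have -> : (fun s => (x s + w s) ord0 i : R) =
      ((fun s => x s ord0 i : R) + (fun s => w s ord0 i : R)).
    by apply/funext => s; rewrite mxE.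
  apply: is_derive_eq.
    apply: is_deriveD; [exact: Hx|apply: Hw; move: tT; by rewrite in_itv].
  have H (a b : 'rV[R]_n) : a ord0 i + (b - a) ord0 i = b ord0 i.
    by rewrite !mxE addrCA subrr addr0.
  exact: H.
exists (fun s => x s + w s); split => //.
- by rewrite wT /delta addrC subrK.
- rewrite x00 [x0 + _]addrC addrK; apply: wd; lra.
(* The crude constant above served for absolute continuity; now that [z] is a trajectory inside the
   ball, it improves to [M], which does not depend on [x] or [y]. *)
- apply: (trajectory_lipschitz fb M0 tz (lexx T)) => s sT.
  by apply: inball => //; exact: w2.
Qed.

(** * Infinite concatenation *)

Lemma is_derive_translate (R : realType) (f : R -> R) (t a d : R) :
  is_derive (t - a) 1 f d -> is_derive t 1 (fun s => f (s - a)) d.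
Proof.
have E : (fun h : R => h^-1 *: (f (h *: 1 + t - a) - f (t - a))) =
         (fun h : R => h^-1 *: (f (h *: 1 + (t - a)) - f (t - a))).
  by apply/funext => h; rewrite addrA.
by move=> [d1 d2]; split; [rewrite /derivable /= E|rewrite /derive /= E].
Qed.

Lemma ae_translate (R : realType) (P : R -> Prop) (a : R) :
  {ae (@lebesgue_measure R), forall t, P t} ->
  {ae (@lebesgue_measure R), forall t, P (t - a)}.
Proof. exact: negligible_translation. Qed.

(* The pieces are indexed backward in time: [z k] runs on
   [[c k.+1, c k]], and the breakpoints [c k] decrease to the initial time. *)
Lemma trajectory_glue (R : realType) (nu : regularity) (n m : nat)
    (S : control_affine_system R nu n m) (x0 : 'rV[R]_n) (M : R)
    (c : nat -> R) (z : nat -> R -> 'rV[R]_n) :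
  0 <= M -> (forall k, c k.+1 < c k) -> (forall k, 0 <= c k) ->
  (forall e : R, 0 < e -> exists k, c k < e) ->
  (forall k, trajectory S (c k - c k.+1) (z k)) ->
  (forall k (s t : R), 0 <= s <= c k - c k.+1 -> 0 <= t <= c k - c k.+1 ->
     `|z k s - z k t| <= M * `|s - t|) ->
  (forall k, z k 0 = z k.+1 (c k.+1 - c k.+2)) ->
  (forall e : R, 0 < e -> exists K, forall k, (K <= k)%N ->
     `|z k (c k - c k.+1) - x0| <= e) ->
  exists x, [/\ trajectory S (c 0) x, x 0 = x0 & x (c 0) = z 0 (c 0 - c 1)].
Proof.
move=> M0 cS c_ge0 c_to0 ztraj zlip zmatch zend.
have c_gt0 k : 0 < c k by have := cS k; have := c_ge0 k.+1; lra.
have cle : {homo c : j k / (j <= k)%N >-> k <= j}.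
  apply: homo_leq => // [a b d|k]; last exact/ltW/cS.
  by move=> h1 h2; exact: le_trans h2 h1.
have /choice[kap Hk] : forall s : R, exists k : nat,
    0 < s <= c 0 -> c k.+1 < s <= c k.
  move=> s; have [sT|_] := boolP (0 < s <= c 0); last by exists 0%N.
  have [s0 sc] := andP sT.
  have ex : exists k, c k < s := c_to0 s s0.
  (* The least index with [c k < s] is positive because [s <= c 0]; its predecessor is the piece
     containing [s]. *)
  case: (ex_minnP ex) => -[|k]; first by rewrite ltNge sc.
  move=> ck kmin; exists k => _; rewrite ck /= leNgt.
  by apply/negP => /kmin; rewrite ltnn.
have kapE k (s : R) : c k.+1 < s <= c k -> kap s = k.
  move=> sk.
  have s0 : 0 < s <= c 0.
    by have := c_gt0 k.+1; have := cle 0%N k (leq0n _); lra.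
  have hk := Hk s s0; have [lt|gt|//] := ltngtP (kap s) k.
    by exfalso; have := cle (kap s).+1 k lt; lra.
  by exfalso; have := cle k.+1 (kap s) gt; lra.
pose X (s : R) := if s <= 0 then x0 else z (kap s) (s - c (kap s).+1).
have X_in k s : c k.+1 < s <= c k -> X s = z k (s - c k.+1).
  move=> sk; rewrite /X (kapE k s sk).
  have -> // : (s <= 0) = false.
  by apply/negbTE; rewrite -ltNge; have := c_gt0 k.+1; lra.
have Xc k : X (c k) = z k (c k - c k.+1) by rewrite (X_in k) // cS lexx.
have X_cl k s : c k.+1 <= s <= c k -> X s = z k (s - c k.+1).
  move=> /andP[]; rewrite le_eqVlt => /orP[/eqP <- _|h1 h2].
    by rewrite subrr zmatch Xc.
  by apply: X_in; rewrite h1.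
have Xlipk k s t : c k <= s -> s <= t -> t <= c 0 ->
    `|X s - X t| <= M * (t - s).
  elim: k s t => [|k IH] s t cs st tc.
    have -> : s = t by lra.
    by rewrite !subrr normr0 mulr0.
  have [cks|cks] := leP (c k) s; first exact: IH.
  have piece a b : c k.+1 <= a -> a <= b -> b <= c k ->
      `|X a - X b| <= M * (b - a).
    move=> ca ab bc; rewrite !(X_cl k); [|lra|lra].
    apply: le_trans (zlip k _ _ _ _) _; [lra|lra|].
    have -> : a - c k.+1 - (b - c k.+1) = - (b - a) by ring.
    by rewrite normrN ger0_norm //; lra.
  have [tck|tck] := leP t (c k); first exact: piece.
  have h1 := piece s (c k) cs (ltW cks) (lexx _).
  have h2 := IH (c k) t (lexx _) (ltW tck) tc.
  by have := ler_distD (X (c k)) (X s) (X t); lra.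
have X0 : X 0 = x0 by rewrite /X lexx.
(* Finitely many pieces never reach time 0: go from [t] down to a breakpoint [c k], where [zend]
   puts [X (c k)] close to [x0]. *)
have Xlip0 t : 0 < t <= c 0 -> `|X 0 - X t| <= M * t.
  move=> t0; rewrite X0; apply/ler_addgt0Pr => e e0.
  have [K HK] := zend e e0.
  have [K' HK'] := c_to0 t ltac:(lra).
  pose k := maxn K K'.
  have ckt : c k < t by apply: le_lt_trans HK'; apply: cle; exact: leq_maxr.
  have h1 := HK k (leq_maxl _ _); rewrite -Xc in h1.
  have h2 := Xlipk k (c k) t (lexx _) (ltW ckt) ltac:(lra).
  have h3 := ler_distD (X (c k)) x0 (X t).
  rewrite distrC in h1.
  have h4 : M * (t - c k) <= M * t.
    by rewrite ler_wpM2l //; have := c_ge0 k; lra.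
  lra.
have Xlip s t : 0 <= s <= c 0 -> 0 <= t <= c 0 -> `|X s - X t| <= M * `|s - t|.
  wlog st : s t / s <= t.
    move=> W sc tc; have [|/ltW] := leP s t; first by move/W; exact.
    by rewrite distrC (distrC s) => /W; exact.
  move=> sc tc; rewrite (distrC s) (@ger0_norm _ (t - s)); last by lra.
  have [s0|s0] := ltP 0 s.
    have [k ck] := c_to0 s s0.
    by apply: (Xlipk k); lra.
  have -> : s = 0 by lra.
  have [t0|t0] := ltP 0 t; first by rewrite subr0; apply: Xlip0; lra.
  have -> : t = 0 by lra.
  by rewrite !subrr normr0 mulr0.
have /choice[u Hu] : forall k, exists u : R -> 'rV[R]_m,
    [/\ forall t, t \in `[0, c k - c k.+1] -> controls S (u t),
        forall i : 'I_m, measurable_fun `[0, c k - c k.+1] (fun t => u t ord0 i)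
      & integral_curve (fun t => field_at S (u t)) (c k - c k.+1) (z k)].
  by move=> k; have [u] := ztraj k; exists u.
(* Time 0 belongs to no piece; the control there takes the admissible value 0. *)
pose U (s : R) := if 0 < s <= c 0 then u (kap s) (s - c (kap s).+1) else 0.
have U_in k s : c k.+1 < s <= c k -> U s = u k (s - c k.+1).
  move=> sk; rewrite /U (kapE k s sk).
  have -> // : 0 < s <= c 0.
  by have := c_gt0 k.+1; have := cle 0%N k (leq0n _); lra.
exists X; split; [|exact: X0|exact: Xc].
exists U; split.
- move=> t _; rewrite /U; case: ifP => [tc|_]; last exact: controls0.
  have [uC _ _] := Hu (kap t); apply: uC; rewrite in_itv /=.
  by have := Hk t tc; lra.
- move=> i.
  have -> : `[0, c 0]%classic = [set 0] `|` \bigcup_k `]c k.+1, c k]%classic.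
    apply/seteqP; split => [t /=|t /=].
      rewrite in_itv /= => /andP[]; rewrite le_eqVlt => /orP[/eqP <-|t0 tc].
        by left.
      by right; exists (kap t) => //=; rewrite in_itv /=; apply: Hk; rewrite t0.
    move=> [->|[k _ /=]]; rewrite in_itv /=; first by rewrite lexx c_ge0.
    rewrite in_itv /= => tk.
    by have := c_gt0 k.+1; have := cle 0%N k (leq0n _); lra.
  apply/measurable_funU => //; first exact: bigcup_measurable.
  split; first exact: measurable_fun_set1.
  apply/measurable_fun_bigcup => // k.
  have mf : measurable_fun `]c k.+1, c k]
      ((fun t => u k t ord0 i) \o (fun t => t - c k.+1)).
    apply: (measurable_comp (F := `[0, c k - c k.+1]%classic)) => //.
    - by move=> _ [t /= + <-]; rewrite !in_itv /=; lra.
    - by have [_ um _] := Hu k; exact: um.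
    - by apply: measurable_funB => //; exact: measurable_cst.
  apply: eq_measurable_fun mf => t; rewrite inE /= in_itv /= => tk.
  by rewrite (U_in k).
- split; first exact: lipschitz_abs_continuous Xlip.
  (* Besides the shifted exceptional sets, all breakpoints are removed, since the glued curve may
     fail to be differentiable there. *)
  have : {ae (@lebesgue_measure R), forall t, forall k, t != c k /\
      (t - c k.+1 \in `[0, c k - c k.+1] -> forall i : 'I_n,
        is_derive (t - c k.+1) 1 (fun s => z k s ord0 i : R)
          (field_at S (u k (t - c k.+1)) (z k (t - c k.+1)) ord0 i))}.
    apply: ae_forall_nat => k; apply: ae_and; first exact: ae_neq.
    have [_ _ [_ aez]] := Hu k.
    exact: (ae_translate (c k.+1) aez).
  move=> /(ae_and (ae_neq 0))/ae_imply; apply => t [t0 Ht].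
  rewrite in_itv /= => tc i.
  have tpos : 0 < t <= c 0 by rewrite lt_neqAle eq_sym t0; lra.
  have tk := Hk t tpos; set k := kap t in tk.
  have [tnk Hz] := Ht k.
  have tk' : c k.+1 < t < c k.
    by rewrite (lt_neqAle t) tnk /=; lra.
  have {}Hz := Hz ltac:(rewrite in_itv /=; lra) i.
  rewrite (U_in k t tk) (X_in k t tk).
  apply: near_eq_is_derive (is_derive_translate Hz).
  have : \forall s \near t, s \in `](c k.+1), (c k)[.
    by apply: near_in_itvoo; rewrite in_itv /=.
  apply: filterS => s; rewrite in_itv /= => sk.
  by rewrite (X_in k s) //; lra.
Qed.

(** * Contraction towards the equilibrium *)

Definition norm1 (R : realType) (n : nat) (x : 'rV[R]_n) : R :=
  \sum_i `|x ord0 i|.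

Lemma norm1_ge0 (R : realType) (n : nat) (x : 'rV[R]_n) : 0 <= norm1 x.
Proof. exact: sumr_ge0. Qed.

Lemma norm1D (R : realType) (n : nat) (x y : 'rV[R]_n) :
  norm1 (x + y) <= norm1 x + norm1 y.
Proof.
rewrite /norm1 -big_split /=; apply: ler_sum => i _.
by rewrite mxE; exact: ler_normD.
Qed.

Lemma norm1N (R : realType) (n : nat) (x : 'rV[R]_n) : norm1 (- x) = norm1 x.
Proof. by apply: eq_bigr => i _; rewrite mxE normrN. Qed.

Lemma normr_le_norm1 (R : realType) (n : nat) (x : 'rV[R]_n) : `|x| <= norm1 x.
Proof.
apply: normr_row_le; first exact: norm1_ge0.
by move=> i; rewrite /norm1 (bigD1 i) //= lerDl; apply: sumr_ge0.
Qed.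

Lemma norm1_le (R : realType) (n : nat) (x : 'rV[R]_n) (d : R) :
  (forall i, `|x ord0 i| <= d) -> norm1 x <= n%:R * d.
Proof.
move=> H; apply: le_trans (_ : \sum_(i < n) d <= _); first exact: ler_sum.
by rewrite sumr_const card_ord mulr_natl.
Qed.

Lemma nth_root_exists (R : realType) (N : nat) (a : R) :
  (0 < N)%N -> 0 < a -> exists2 t, 0 < t & t ^+ N = a.
Proof.
move=> N0 a0; exists (a `^ (N%:R^-1)); first exact: powR_gt0.
rewrite -powR_mulrn ?powR_ge0 // -powRrM mulVf ?powRr1 ?ltW //.
by rewrite pnatr_eq0 -lt0n.
Qed.

(** Turns a contraction factor [1 - N * x] of distances into a ratio [1 - x] of durations. *)
Lemma bernoulli_le (R : realType) (x : R) (N : nat) :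
  0 <= x <= 1 -> 1 - N%:R * x <= (1 - x) ^+ N.
Proof.
move=> x01; elim: N => [|N IH]; first by rewrite expr0; lra.
rewrite exprS.
have h := ler_wpM2l (_ : 0 <= 1 - x) IH.
apply: le_trans (h _); last by lra.
have : 0 <= N%:R * (x * x) by rewrite !mulr_ge0 //; lra.
by rewrite -natr1; lra.
Qed.

Lemma variation_estimate (R : realType) (nu : regularity) (n m : nat)
    (S : control_affine_system R nu n m) (x0 v : 'rV[R]_n) (N : nat) :
  Defs.variations S N x0 v ->
  exists K t0 : R, [/\ 0 <= K, 0 < t0 & forall t, 0 < t <= t0 ->
    exists T x, [/\ 0 <= T <= t, trajectory S T x, x 0 = x0 &
      forall i, `|(x T - (x0 + t ^+ N *: v)) ord0 i| <= K * t ^+ N.+1]].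
Proof.
move=> [gam [gr [l cvl]]].
move/cvgrPdist_le : cvl => /(_ 1 ltr01)[e /= e0 He].
(* [|l| + 1] bounds the quotient near 0, and [e / 2] turns the open range of [t] into a closed
   one. *)
exists (`|l| + 1), (e / 2); split; [by rewrite addr_ge0|by rewrite divr_gt0|].
move=> t /andP[t0 te].
have [T [x [Tt tx x00 xT]]] := gr t (ltW t0).
exists T, x; split => // i; rewrite xT.
apply: le_trans (normr_le_enorm _ _) _.
have := He t; rewrite /= sub0r normrN gtr0_norm // => /(_ _ t0) /=.
move=> /(_ ltac:(lra)); set q := enorm _ => h.
have tN : 0 < t ^+ N.+1 by rewrite exprn_gt0.
rewrite -ler_pdivrMr //.
have := ler_norm (q / t ^+ N.+1 - l); rewrite distrC; have := ler_norm l; lra.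
Qed.

Definition steers_back (R : realType) (nu : regularity) (n m : nat)
    (S : control_affine_system R nu n m) (x0 : 'rV[R]_n) (M tau : R)
    (y : 'rV[R]_n) (d : R) (z : R -> 'rV[R]_n) : Prop :=
  [/\ trajectory S tau z, z tau = y, norm1 (z 0 - x0) <= d &
      forall s t, 0 <= s <= tau -> 0 <= t <= tau ->
        `|z s - z t| <= M * `|s - t|].

(** With [t ^+ N = al * r] the variation moves by [sg * r] along coordinate [i], exactly the
    displacement of [y] there, so cancelling it lowers the 1-norm by [r]. The errors of the
    variation and of the pullback are constants times [r * t], together at most [r / 2]. *)
Lemma direction_step (R : realType) (nu : regularity) (n m : nat)
    (S : control_affine_system R nu n m) (x0 : 'rV[R]_n) (N : nat)
    (rho L M al : R) (sg : R) (i : 'I_n) :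
  (0 < N)%N -> field_bounds S x0 rho L M -> 0 < rho -> 0 <= L -> 0 <= M ->
  `|sg| = 1 -> 0 < al ->
  Defs.variations S N x0 ((al^-1 * sg) *: delta_mx ord0 i) ->
  exists2 r0 : R, 0 < r0 & forall (r : R) (y : 'rV[R]_n), 0 < r <= r0 ->
    y ord0 i - x0 ord0 i = sg * r -> norm1 (y - x0) <= n.+1%:R * r ->
    exists tau z, [/\ 0 <= tau, tau ^+ N <= al * r &
      steers_back S x0 M tau y (norm1 (y - x0) - r / 2) z].
Proof.
move=> N0 fb rho0 L0 M0 sg1 al0 /variation_estimate[K [t0 [K0 t00 HK]]].
(* [P * r * t] bounds the 1-norm error of the variation; [Q * r * t] adds that of the pullback, with
   [|y - x T| <= r * (n.+1 + P)]. *)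
pose P : R := n%:R * K * al.
pose Q : R := P + 2 * n%:R * L * (n.+1%:R + P).
have P0 : 0 <= P by rewrite /P !mulr_ge0 // ltW.
have n0 : 0 <= n%:R :> R by [].
have nS : n.+1%:R = n%:R + 1 :> R by rewrite natr1.
have nP : 0 <= n.+1%:R + P by rewrite addr_ge0.
have nP1 : 0 < n.+1%:R + P by rewrite nS; lra.
have Q0 : 0 <= Q by rewrite /Q addr_ge0 // !mulr_ge0.
(* Each smallness condition on [t] is a summand, so [t * A <= 1] yields all of [B1] to [B5]. *)
pose A := 1 + t0^-1 + 4 * L + (2 * M + 1) / rho + 2 * Q.
have t0V : 0 < t0^-1 by rewrite invr_gt0.
have MV : 0 < (2 * M + 1) / rho by rewrite divr_gt0 //; lra.
have A0 : 0 < A by rewrite /A; lra.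
pose t1 := A^-1.
have t10 : 0 < t1 by rewrite invr_gt0.
exists (Num.min (t1 ^+ N / al) (rho / (4 * (n.+1%:R + P)))).
  by rewrite lt_min !divr_gt0 ?exprn_gt0 ?mulr_gt0.
move=> r y; rewrite le_min => /and3P[r0 r1 r2] yi Dy.
have [t tp tN] := nth_root_exists N0 (mulr_gt0 al0 r0).
have tt1 : t <= t1.
  have : t ^+ N <= t1 ^+ N by rewrite tN mulrC -ler_pdivlMr.
  by rewrite ler_pXn2r // nnegrE ltW.
have tA : t * A <= 1 by rewrite -ler_pdivlMr // div1r.
have B1 : t <= 1.
  have : 0 <= t * (t0^-1 + 4 * L + (2 * M + 1) / rho + 2 * Q).
    by rewrite mulr_ge0 ?ltW //; lra.
  rewrite /A in tA; lra.
have B2 : t <= t0.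
  rewrite -[t0]mul1r -ler_pdivrMr //.
  have : 0 <= t * (1 + 4 * L + (2 * M + 1) / rho + 2 * Q).
    by rewrite mulr_ge0 ?ltW //; lra.
  rewrite /A in tA; lra.
have B3 : 4 * L * t <= 1.
  have : 0 <= t * (1 + t0^-1 + (2 * M + 1) / rho + 2 * Q).
    by rewrite mulr_ge0 ?ltW //; lra.
  rewrite /A in tA; lra.
have B4 : (2 * M + 1) * t <= rho.
  rewrite -[rho]mul1r -ler_pdivrMr // mulrAC.
  have : 0 <= t * (1 + t0^-1 + 4 * L + 2 * Q).
    by rewrite mulr_ge0 ?ltW //; lra.
  rewrite /A in tA; lra.
have B5 : 2 * Q * t <= 1.
  have : 0 <= t * (1 + t0^-1 + 4 * L + (2 * M + 1) / rho).
    by rewrite mulr_ge0 ?ltW //; lra.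
  rewrite /A in tA; lra.
have [T [x [/andP[T0 Tt] tx x00 xT]]] := HK t ltac:(lra).
exists T.
set D := norm1 (y - x0) in Dy *.
pose w : 'rV[R]_n := (sg * r) *: delta_mx ord0 i.
have wE : t ^+ N *: ((al^-1 * sg) *: delta_mx ord0 i) = w.
  rewrite scalerA tN /w; congr (_ *: _); field; exact: lt0r_neq0.
rewrite wE in xT.
have g1 : norm1 (x T - (x0 + w)) <= P * r * t.
  apply: le_trans (norm1_le xT) _.
  by rewrite exprS tN /P; lra.
have g2 : norm1 (y - x0 - w) = D - r.
  rewrite /D /norm1 (bigD1 i) //= [in RHS](bigD1 i) //= !mxE !eqxx mulr1 yi.
  rewrite subrr normr0 add0r normrM sg1 mul1r gtr0_norm //.
  rewrite [r + _]addrC addrK; apply: eq_bigr => j ji.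
  by rewrite !mxE (negbTE ji) andbF mulr0 subr0.
have dE : y - x T = (y - x0 - w) - (x T - (x0 + w)).
  by apply/rowP => j; rewrite !mxE; ring.
have g3 : norm1 (y - x T) <= D - r + P * r * t.
  rewrite dE; apply: le_trans (norm1D _ _) _; rewrite norm1N; lra.
have Prt : P * r * t <= P * r.
  by rewrite ler_piMr // mulr_ge0 // ltW.
have g4 : `|y - x T| <= r * (n.+1%:R + P).
  apply: le_trans (normr_le_norm1 _) _; lra.
have [|||z [tz zT z0 zl]] :=
  trajectory_pullback (y := y) fb L0 M0 T0 _ _ tx x00.
- have := ler_wpM2l L0 Tt; lra.
- have := ler_wpM2l M0 Tt; lra.
- rewrite ler_pdivlMr ?mulr_gt0 // in r2; lra.
exists z; split => //.
  rewrite -tN; apply: lerXn2r => //; rewrite nnegrE //; lra.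
split => //.
have h1 : norm1 (z 0 - x0 - (y - x T)) <= n%:R * (2 * L * T * `|y - x T|).
  apply: norm1_le => j; apply: le_trans z0; exact: normr_row_coord.
have h2 : norm1 (z 0 - x0) <= norm1 (z 0 - x0 - (y - x T)) + norm1 (y - x T).
  by rewrite -{1}(subrK (y - x T) (z 0 - x0)); exact: norm1D.
have h3 : n%:R * (2 * L * T * `|y - x T|) <=
    n%:R * (2 * L * t * (r * (n.+1%:R + P))).
  rewrite ler_wpM2l // ler_pM // ?mulr_ge0 // ler_wpM2l // mulr_ge0 //.
have h4 : r * (2 * Q * t) <= r * 1 by rewrite ler_wpM2l // ltW.
rewrite /Q in h4; lra.
Qed.

(** The signed basis vector is nonzero, so its scaling factor in the cone cannot vanish and can be
    divided out. *)
Lemma cone_direction (R : realType) (nu : regularity) (n m : nat)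
    (S : control_affine_system R nu n m) (x0 : 'rV[R]_n) (N : nat)
    (i : 'I_n) (sg : R) :
  variation_cone S N x0 = [set: 'rV[R]_n] -> `|sg| = 1 ->
  exists2 al, 0 < al &
    Defs.variations S N x0 ((al^-1 * sg) *: delta_mx ord0 i).
Proof.
move=> hK sg1.
have : variation_cone S N x0 (sg *: delta_mx ord0 i) by rewrite hK.
move=> [al /= al0 [v Hv e]].
have alp : 0 < al.
  rewrite lt_neqAle al0 andbT; apply/eqP => al00.
  move: e; rewrite -al00 scale0r => /rowP /(_ i); rewrite !mxE !eqxx mulr1 => e.
  by move: sg1; rewrite -e normr0 => /eqP; rewrite eq_sym oner_eq0.
exists al => //; rewrite -scalerA -e scalerA mulVf ?scale1r //.
exact: lt0r_neq0.
Qed.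

Lemma trajectory_cst (R : realType) (nu : regularity) (n m : nat)
    (S : control_affine_system R nu n m) (x0 : 'rV[R]_n) (T : R) :
  equilibrium S x0 -> trajectory S T (fun=> x0).
Proof.
move=> hx0; exists (fun=> 0); split.
- by move=> t _; exact: controls0.
- by move=> i; exact: measurable_cst.
split.
  apply: (@lipschitz_abs_continuous _ _ _ 0) => // s t _ _.
  by rewrite subrr normr0 mul0r.
apply: aeW => t _ i.
have -> : field_at S 0 x0 ord0 i = 0.
  rewrite field_atE hx0 mxE add0r big1 // => k _.
  by rewrite mxE mul0r.
exact: is_derive_cst.
Qed.

(** Averaging: with [n.+1] in place of [n], weak inequalities on all coordinates already contradict
    [0 < norm1 x]. *)
Lemma large_coordinate (R : realType) (n : nat) (x : 'rV[R]_n) :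
  0 < norm1 x -> exists i, norm1 x <= n.+1%:R * `|x ord0 i|.
Proof.
move=> x0; apply: contrapT => H.
have Hi i : n.+1%:R * `|x ord0 i| <= norm1 x.
  by rewrite leNgt; apply/negP => h; apply: H; exists i; exact: ltW.
have : n.+1%:R * norm1 x <= n%:R * norm1 x.
  rewrite {1}/norm1 mulr_sumr; apply: le_trans (ler_sum _ (fun i _ => Hi i)) _.
  by rewrite sumr_const card_ord mulr_natl.
by rewrite -natr1; lra.
Qed.

(** Makes the estimate uniform over the [2 * n] signed basis directions. A coordinate of modulus
    [r >= D / n.+1] loses [r / 2], whence the factor; [s] is a time budget fixed in advance, into
    which the piece must fit. *)
Lemma contraction_step (R : realType) (nu : regularity) (n m : nat)
    (S : control_affine_system R nu n m) (x0 : 'rV[R]_n) (N : nat)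
    (rho L M : R) :
  (0 < N)%N -> field_bounds S x0 rho L M -> 0 < rho -> 0 <= L -> 0 <= M ->
  equilibrium S x0 -> variation_cone S N x0 = [set: 'rV[R]_n] ->
  exists al r0 : R, [/\ 0 < al, 0 < r0 & forall (y : 'rV[R]_n) (s : R),
    0 < s -> norm1 (y - x0) <= r0 -> al * norm1 (y - x0) <= s ^+ N ->
    exists tau z, 0 < tau <= s /\
      steers_back S x0 M tau y ((1 - (2 * n.+1%:R)^-1) * norm1 (y - x0)) z].
Proof.
move=> N0 fb rho0 L0 M0 hx0 hK.
pose sg (b : bool) : R := (-1) ^+ b.
have sg1 b : `|sg b| = 1 by rewrite /sg normrX normrN1 expr1n.
pose step (p : 'I_n * bool) (al r0 : R) := forall (r : R) (y : 'rV[R]_n),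
  0 < r <= r0 -> y ord0 p.1 - x0 ord0 p.1 = sg p.2 * r ->
  norm1 (y - x0) <= n.+1%:R * r ->
  exists tau z, [/\ 0 <= tau, tau ^+ N <= al * r &
    steers_back S x0 M tau y (norm1 (y - x0) - r / 2) z].
have [|r0 r00 Hr0] := @finite_common_radius R ('I_n * bool)%type
    (fun p r0 => exists2 al, 0 < al & step p al r0).
  move=> [i b].
  have [al al0 Hv] := cone_direction i hK (sg1 b).
  have [r0 r00 H] := direction_step N0 fb rho0 L0 M0 (sg1 b) al0 Hv.
  exists r0 => // s /andP[s0 sr]; exists al => // r y rs; apply: H.
  by apply/andP; split; lra.
have /choice[alp Halp] : forall p, exists al, 0 < al /\ step p al r0.
  by move=> p; have [|al al0 H] := Hr0 p r0; [rewrite r00 lexx|exists al].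
have sumge0 : 0 <= \sum_p alp p by apply: sumr_ge0 => p _; exact/ltW/(Halp p).1.
exists (1 + \sum_p alp p), r0; split => //; first by lra.
move=> y s s0 yr ys; set D := norm1 (y - x0) in yr ys *.
(* When [y = x0], rest at the equilibrium for time [s]: gluing needs strictly decreasing
   breakpoints, hence pieces of positive duration. *)
have [D0|Dp] := leP D 0.
  have yx : y = x0.
    apply/eqP; rewrite -subr_eq0 -normr_le0.
    exact: le_trans (normr_le_norm1 _) D0.
  have DE : D = 0 by apply/eqP; rewrite eq_le D0 norm1_ge0.
  exists s, (fun=> x0); split; first by rewrite s0 lexx.
  split => //; first exact: trajectory_cst.
    by rewrite DE mulr0 -DE /D yx.
  by move=> a b _ _; rewrite subrr normr0 mulr_ge0.
have [i Di] := large_coordinate Dp; rewrite !mxE -/D in Di.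
set r := `|y ord0 i - x0 ord0 i| in Di.
have nS : 0 < n.+1%:R :> R by [].
have rp : 0 < r.
  by rewrite -(pmulr_rgt0 _ nS); exact: lt_le_trans Di.
have rD : r <= D.
  apply: le_trans (normr_le_norm1 _).
  by have := normr_row_coord (y - x0) i; rewrite !mxE.
pose b := y ord0 i - x0 ord0 i < 0.
have yi : y ord0 i - x0 ord0 i = sg b * r.
  by rewrite /sg /r /b -realEsign ?num_real.
have [|tau [z [tau0 tauN [tz zT z0 zl]]]] := (Halp (i, b)).2 r y _ yi Di.
  by apply/andP; split; lra.
rewrite -/D in z0.
have rn : (2 * n.+1%:R)^-1 * D <= r / 2.
  by rewrite invfM -mulrA mulrC [leLHS]mulrC (mulrC r) ler_wpM2l // ler_pdivrMl.
(* A piece of zero duration would start at [y], against the strict decrease of the distance. *)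
have taup : 0 < tau.
  rewrite lt_neqAle tau0 andbT; apply/eqP => t00.
  by move: z0; rewrite t00 zT -/D; lra.
exists tau, z; split; last first.
  by split => //; apply: le_trans z0 _; rewrite mulrBl mul1r lerB.
have : tau ^+ N <= s ^+ N.
  apply: le_trans tauN _; apply: le_trans ys.
  apply: ler_pM => //; [exact/ltW/(Halp _).1|exact: ltW|].
  rewrite (bigD1 (i, b)) //=.
  have : 0 <= \sum_(p | p != (i, b)) alp p.
    by apply: sumr_ge0 => p _; exact/ltW/(Halp p).1.
  lra.
by rewrite ler_pXn2r ?nnegrE ?(ltW taup) ?(ltW s0) // => ->; rewrite taup.
Qed.

(** * The two implications between growth rate and variations *)

Lemma enormZ (R : realType) (n : nat) (c : R) (x : 'rV[R]_n) :
  enorm (c *: x) = `|c| * enorm x.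
Proof.
rewrite /enorm -sqrtr_sqr -sqrtrM ?sqr_ge0 // mulr_sumr; congr Num.sqrt.
by apply: eq_bigr => i _; rewrite mxE exprMn.
Qed.

Lemma reachable_le (R : realType) (nu : regularity) (n m : nat)
    (S : control_affine_system R nu n m) (s t : R) (x0 y : 'rV[R]_n) :
  s <= t -> reachable S s x0 y -> reachable S t x0 y.
Proof.
move=> st [T [x [/andP[T0 Ts] tx x00 xT]]]; exists T, x; split => //.
by rewrite T0 (le_trans Ts st).
Qed.

Lemma growth_variation_cone (R : realType) (nu : regularity) (n m : nat)
    (S : control_affine_system R nu n m) (x0 : 'rV[R]_n) (N : nat) :
  equilibrium S x0 -> growth_rate_condition S N x0 ->
  variation_cone S N x0 = [set: 'rV[R]_n].
Proof.
move=> hx0 [C [T [C0 T0 H]]]; apply/seteqP; split => // w _.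
pose al := enorm w / C + 1.
have wC : 0 <= enorm w / C by rewrite divr_ge0 ?enorm_ge0 // ltW.
have al0 : 0 < al by rewrite /al; lra.
pose v := al^-1 *: w.
have vC : enorm v <= C.
  rewrite enormZ gtr0_norm ?invr_gt0 // ler_pdivrMl // /al mulrDl.
  rewrite divfK ?gt_eqF //.
  by rewrite mul1r lerDl ltW.
exists al; first exact: ltW.
exists v; last by rewrite /v scalerA divff ?scale1r // gt_eqF.
(* At [t = 0] the growth condition is silent and the constant trajectory is used; beyond [T] the
   curve is frozen and stays reachable. For small [t > 0] the remainder is exactly zero. *)
exists (fun t => if t <= 0 then x0 else x0 + Num.min t T ^+ N *: v); split.
  move=> t t0; case: ifPn => [_|].
    exists 0, (fun=> x0); split => //; first by rewrite lexx.
    exact: trajectory_cst.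
  rewrite -ltNge => tp.
  have m0 : 0 < Num.min t T by rewrite lt_min tp.
  apply: (@reachable_le _ _ _ _ _ (Num.min t T)); first by rewrite ge_min lexx.
  apply: H; first by rewrite m0 ge_min lexx orbT.
  rewrite /eclosed_ball /= addrC addKr enormZ ger0_norm; last first.
    by rewrite exprn_ge0 // ltW.
  by rewrite mulrC ler_wpM2r // exprn_ge0 // ltW.
exists 0; apply/cvgrPdist_le => e e0; near=> t.
have t0 : 0 < t by near: t; exact: nbhs_right_gt.
have tT : t < T by near: t; exact: nbhs_right_lt.
rewrite [t <= 0]leNgt t0 /= min_l; last exact: ltW.
rewrite subrr /enorm big1 ?sqrtr0 ?mul0r ?subrr ?normr0; first exact: ltW.
by move=> i _; rewrite mxE expr0n.
Unshelve. all: by end_near. Qed.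

Lemma variation_cone_growth (R : realType) (nu : regularity) (n m : nat)
    (S : control_affine_system R nu n m) (x0 : 'rV[R]_n) (N : nat) :
  controls S = [set u : 'rV[R]_m | forall i : 'I_m, -1 <= u ord0 i <= 1] ->
  equilibrium S x0 -> (0 < N)%N ->
  variation_cone S N x0 = [set: 'rV[R]_n] -> growth_rate_condition S N x0.
Proof.
move=> hC hx0 N0 hK.
have [rho [L [M [rho0 L0 M0 fb]]]] := field_bounds_exist x0 hC.
have [al [r0 [al0 r00 step]]] := contraction_step N0 fb rho0 L0 M0 hx0 hK.
have Np : 1 <= N%:R :> R by rewrite ler1n.
have np : 1 <= n.+1%:R :> R by rewrite ler1n.
(* Then [N * e] is the relative decrease of the distance in one step, and Bernoulli's inequality
   gives [q ^+ N >= 1 - N * e]. *)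
pose e := (2 * n.+1%:R)^-1 / N%:R : R.
have th0 : 0 < (2 * n.+1%:R)^-1 :> R by rewrite invr_gt0; lra.
have th1 : (2 * n.+1%:R)^-1 <= 1 / 2 :> R.
  by rewrite div1r lef_pV2 ?posrE; lra.
have e0 : 0 < e by rewrite divr_gt0 //; lra.
have e1 : e <= 1 / 2.
  apply: le_trans th1; rewrite ler_pdivrMr; last by lra.
  by rewrite ler_peMr // ltW.
pose q := 1 - e.
have q01 : 0 < q < 1 by rewrite /q; lra.
have qN : 1 - (2 * n.+1%:R)^-1 <= q ^+ N.
  have -> : (2 * n.+1%:R)^-1 = N%:R * e.
    by rewrite /e [N%:R * _]mulrC divfK //; apply: lt0r_neq0; lra.
  by apply: bernoulli_le; lra.
(* Makes [al] times the distance bound [a * (t * q ^+ k) ^+ N] equal to the N-th power of the budget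
   [sk k]. *)
pose a := (1 - q) ^+ N / al.
have a0 : 0 < a by rewrite divr_gt0 // exprn_gt0 //; lra.
(* The divisor [n.+1] passes from the Euclidean norm to the 1-norm. From [t <= 1] follows
   [(t * q ^+ k) ^+ N <= t * q ^+ k], and then [a * t <= r0] keeps every iterate in the range of
   [step]. *)
exists (a / n.+1%:R), (Num.min 1 (r0 / a)); split.
- by rewrite divr_gt0 //; lra.
- by rewrite lt_min ltr01 divr_gt0.
move=> t; rewrite le_min => /and3P[t0 t1 tr] y Hy.
have Hy1 : norm1 (y - x0) <= a * t ^+ N.
  apply: le_trans (norm1_le (fun i => normr_le_enorm _ i)) _.
  have tN : 0 <= t ^+ N by rewrite exprn_ge0 // ltW.
  have h : n%:R * enorm (y - x0) <= n.+1%:R * enorm (y - x0).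
    by rewrite ler_wpM2r ?enorm_ge0 // ler_nat.
  apply: le_trans h _; rewrite mulrC -ler_pdivlMr; last by lra.
  by rewrite mulrAC.
(* The hypotheses of [step] move behind the choice, so that the iterates can be defined before their
   distance bound is proved. *)
have /choice[f Hf] : forall p : 'rV[R]_n * R,
    exists g : R * (R -> 'rV[R]_n), 0 < p.2 -> norm1 (p.1 - x0) <= r0 ->
    al * norm1 (p.1 - x0) <= p.2 ^+ N -> 0 < g.1 <= p.2 /\
    steers_back S x0 M g.1 p.1
      ((1 - (2 * n.+1%:R)^-1) * norm1 (p.1 - x0)) g.2.
  move=> [y' s]; have [H|H] := pselect (0 < s /\
      norm1 (y' - x0) <= r0 /\ al * norm1 (y' - x0) <= s ^+ N).
    have [tau [z Hz]] := step y' s H.1 H.2.1 H.2.2.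
    by exists (tau, z).
  by exists (0, fun=> 0) => /= h1 h2 h3; exfalso; apply: H.
pose sk k := (1 - q) * (t * q ^+ k).
pose yk := fix F k := if k is k'.+1 then (f (F k', sk k')).2 0 else y.
pose tau k := (f (yk k, sk k)).1.
pose z k := (f (yk k, sk k)).2.
have qk k : 0 < q ^+ k by apply: exprn_gt0; lra.
have qk1 k : q ^+ k <= 1 by apply: exprn_ile1; lra.
have sk0 k : 0 < sk k by rewrite /sk !mulr_gt0 //; lra.
have akle k : a * (t * q ^+ k) ^+ N <= a * (t * q ^+ k).
  rewrite ler_wpM2l //; first exact: ltW.
  rewrite -[leRHS]expr1; apply: ler_wiXn2l => //.
    by rewrite mulr_ge0 // ltW.
  by apply: mulr_ile1 => //; exact: ltW.
have inv k : norm1 (yk k - x0) <= a * (t * q ^+ k) ^+ N ->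
    0 < tau k <= sk k /\ steers_back S x0 M (tau k) (yk k)
      ((1 - (2 * n.+1%:R)^-1) * norm1 (yk k - x0)) (z k).
  move=> H; apply: (Hf (yk k, sk k)) => //=.
    apply: le_trans H _; apply: le_trans (akle k) _.
    rewrite mulrC -ler_pdivlMr //; apply: le_trans tr.
    by rewrite ler_piMr // ltW.
  have -> : sk k ^+ N = al * (a * (t * q ^+ k) ^+ N).
    by rewrite /sk exprMn /a mulrA mulrC [al * _]mulrC divfK ?gt_eqF // mulrC.
  by rewrite ler_wpM2l // ltW.
have Dk k : norm1 (yk k - x0) <= a * (t * q ^+ k) ^+ N.
  elim: k => [|k IH]; first by rewrite expr0 mulr1.
  have [_ [_ _ z0 _]] := inv k IH.
  apply: le_trans z0 _.
  have -> : a * (t * q ^+ k.+1) ^+ N = q ^+ N * (a * (t * q ^+ k) ^+ N).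
    by rewrite exprS mulrCA exprMn mulrCA.
  apply: ler_pM => //; [|exact: norm1_ge0].
  by rewrite subr_ge0; apply: le_trans th1 _; lra.
have tauP k := (inv k (Dk k)).1.
have zP k := (inv k (Dk k)).2.
pose sig k := \sum_(j < k) tau j.
have sigS k : sig k.+1 = sig k + tau k by rewrite /sig big_ord_recr.
have sigt k : sig k <= t * (1 - q ^+ k).
  elim: k => [|k IH]; first by rewrite /sig big_ord0 expr0 subrr mulr0.
  rewrite sigS exprS; have := tauP k; rewrite /sk; lra.
have sigt' k : sig k <= t.
  apply: le_trans (sigt k) _; rewrite ler_piMr //; first exact: ltW.
  by have := qk k; lra.
(* The total duration, as the limit of the partial sums; measured back from it, the breakpoints
   [c k] decrease to 0. *)
pose T := sup (range sig).
have supT : has_sup (range sig).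
  by split; [exists (sig 0%N), 0%N|exists t => _ [k _ <-]].
have sigT k : sig k <= T by apply: ub_le_sup; [exact: supT.2|exists k].
have Tt : T <= t by apply: ge_sup; [exact: supT.1|move=> _ [k _ <-]].
pose c k := T - sig k.
have cE k : c k - c k.+1 = tau k by rewrite /c sigS; ring.
have [|||||||x [tx x00 xT]] := @trajectory_glue R nu n m S x0 M c z M0.
- by move=> k; have := cE k; have := tauP k; lra.
- by move=> k; rewrite subr_ge0.
- move=> d d0; have [_ [k _ <-] h] := sup_adherent d0 supT.
  by exists k; rewrite /c -/T; move: h; rewrite -/T; lra.
- by move=> k; rewrite cE; have [] := zP k.
- by move=> k; rewrite cE; have [] := zP k.
- by move=> k; rewrite cE; have [_ -> _ _] := zP k.+1.
- move=> d d0.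
  have : (fun k => q ^+ k) @ \oo --> (0 : R).
    by apply: cvg_expr; rewrite gtr0_norm; lra.
  move=> /cvgrPdist_le /(_ (d / a)); rewrite divr_gt0 // => /(_ isT)[K _ HK].
  exists K => k Kk; rewrite cE; have [_ -> _ _] := zP k.
  apply: le_trans (normr_le_norm1 _) _; apply: le_trans (Dk k) _.
  apply: le_trans (akle k) _.
  have := HK k Kk; rewrite /= sub0r normrN gtr0_norm // ler_pdivlMr // => h.
  have h2 : t * q ^+ k <= q ^+ k by rewrite ler_piMl // ltW.
  have := ler_wpM2l (ltW a0) h2; lra.
have c0 : c 0%N = T by rewrite /c /sig big_ord0 subr0.
exists T, x; split => //.
- by rewrite Tt andbT -c0 subr_ge0.
- by rewrite -c0.
- by rewrite -c0 xT cE; have [_ -> _ _] := zP 0%N.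
Qed.

Theorem theorem5p2 (R : realType) (nu : regularity) (n m : nat)
    (S : control_affine_system R nu n m) (x0 : 'rV[R]_n) (N : nat)
    (hS : standing_assumption S) (hx0 : equilibrium S x0) (hN : (0 < N)%N) :
  growth_rate_condition S N x0 <-> variation_cone S N x0 = [set: 'rV[R]_n].
Proof.
split; first exact: growth_variation_cone.
exact: (variation_cone_growth hS.2).
Qed.
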